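(* Let $G$ be a Hilbert space of dimension $d\in\mathbb{N}\cup\{\infty\}$, let $e\in G$ be a unit vector, and let $H\in\mathscr{B}(G)$ be self-adjoint with $\{H\}'\cap\{ee^*\}'=\mathbb{C}\mathbf{1}$. Let $$L(X):=ee^*Xee^*-\tfrac12\bigl(ee^*X+Xee^*\bigr)+i[H,X]\qquad(X\in\mathscr{B}(G)),$$ which is the generator of a uniformly continuous Markov semigroup on $\mathscr{B}(G)$. Then every commutative von Neumann subalgebra $\mathcal{C}\ni\mathbf{1}$ of $\mathscr{B}(G)$ with $L(\mathcal{C})\subset\mathcal{C}$ satisfies $\dim\mathcal{C}\le 2$. Consequently, if $d\ge3$, then $L$ leaves no maximal abelian subalgebra of $\mathscr{B}(G)$ invariant. In particular, for every finite $d\ge 3$, and also for separable infinite-dimensional $G$, there exists a Markov semigroup on $\mathscr{B}(G)$ (on $M_d$ if $d<\infty$) that leaves no maximal abelian subalgebra invariant.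
   Context: $ee^*$ denotes the rank-one projection $g\mapsto e\langle e,g\rangle$. $\{A\}'$ is the commutant of $A$ in $\mathscr{B}(G)$. $[A,B]=AB-BA$. A Markov semigroup on $\mathscr{B}(G)$ is a one-parameter semigroup $(T_t)_{t\ge0}$ of normal unital completely positive maps on $\mathscr{B}(G)$; for a bounded generator $L$ one has $T_t=e^{tL}$. A maximal abelian subalgebra (masa) of $\mathscr{B}(G)$ is a commutative von Neumann subalgebra containing $\mathbf{1}$ and not properly contained in another commutative subalgebra. A subalgebra $\mathcal{C}$ is invariant under the semigroup if $T_t(\mathcal{C})\subset\mathcal{C}$ for all $t\ge0$, equivalently (for bounded generator) $L(\mathcal{C})\subset\mathcal{C}$. *)

(* Defs.v *)
From HB Require Import structures.
From mathcomp Require Import all_boot all_order all_algebra.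
From mathcomp Require Import sesquilinear complex.
From mathcomp Require Import all_classical reals topology normedtype.

Set Implicit Arguments.
Unset Strict Implicit.
Unset Printing Implicit Defensive.

Import Order.TTheory GRing.Theory Num.Theory Num.Def.
Import numFieldNormedType.Exports.

Local Open Scope classical_set_scope.
Local Open Scope complex_scope.
Local Open Scope ring_scope.

(* [ip] is linear in its first argument and conjugate-linear in the second, so
   the inner product <e, g> that is linear in g is [ip g e]. *)
HB.mixin Record NormedModule_isHilbert (R : realType) (G : Type)
    of CompleteNormedModule R[i] G := {
  ip : {dot G for (@conjC R[i])} ;
  ip_norm : forall x : G, ip x x = `|x| ^+ 2 }.

#[short(type="hilbertType")]
HB.structure Definition Hilbert (R : realType) :=
  {G of NormedModule_isHilbert R G & CompleteNormedModule R[i] G}.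

Section hilbert_space.
Context (R : realType) (G : hilbertType R).

Definition orthonormal_family (I : eqType) (u : I -> G) :=
  forall i j, ip (u i) (u j) = (i == j)%:R.

Definition hilbert_dim_ge (n : nat) :=
  exists u : 'I_n -> G, orthonormal_family u.

(* The second conjunct makes the orthonormal family a basis. *)
Definition hilbert_dim (n : nat) :=
  exists u : 'I_n -> G, orthonormal_family u /\
    forall x, x = \sum_i ip x (u i) *: u i.

Definition hilbert_infinite := forall n, hilbert_dim_ge n.

Definition hilbert_separable := exists S : set G, countable S /\ dense S.

End hilbert_space.

Arguments hilbert_dim {R} G n.
Arguments hilbert_dim_ge {R} G n.
Arguments hilbert_infinite {R} G.
Arguments hilbert_separable {R} G.

Section bounded_operators.
Context (R : realType) (G : hilbertType R).

Definition bounded_op : {pred G -> G} :=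
  mem [set f : G -> G | linear f /\ continuous f].

Record bop := Bop { bop_fun :> G -> G ; bop_funP : bop_fun \in bounded_op }.

HB.instance Definition _ := [isSub for bop_fun].
HB.instance Definition _ := [Choice of bop by <:].

Lemma bopP (A B : bop) : A = B <-> A =1 B.
Proof. by split=> [->//|AB]; exact/val_inj/funext. Qed.

Lemma bop_linear (A : bop) : linear A.
Proof. by have := bop_funP A; rewrite inE => -[]. Qed.

Lemma bop_continuous (A : bop) : continuous A.
Proof. by have := bop_funP A; rewrite inE => -[]. Qed.

HB.instance Definition _ (A : bop) :=
  GRing.isLinear.Build R[i] G G _ A (bop_linear A).

Lemma bounded_op_submod_closed : submod_closed bounded_op.
Proof.
split.
  by rewrite inE; split=> [a x y|x]; [rewrite scaler0 addr0|exact: cst_continuous].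
move=> a f g; rewrite !inE => -[lf cf] [lg cg].
change (linear (fun x => a *: f x + g x) /\ continuous (fun x => a *: f x + g x)).
split=> [b x y|x].
  by rewrite lf lg !scalerDr !scalerA mulrC addrACA.
apply: (@cvgD R[i] G G); last exact: cg.
by apply: (@cvgZl_tmp R[i] G G); exact: cf.
Qed.

HB.instance Definition _ :=
  GRing.isSubmodClosed.Build _ _ bounded_op bounded_op_submod_closed.
HB.instance Definition _ := [SubChoice_isSubLmodule of bop by <:].

Lemma bop1_subproof : (@id G) \in bounded_op.
Proof. by rewrite inE; split=> // x; exact: cvg_id. Qed.

Definition bop1 : bop := Bop bop1_subproof.

Lemma bopM_subproof (A B : bop) : (fun x => A (B x)) \in bounded_op.
Proof.
rewrite inE; split=> [a x y|x]; first by rewrite !linearP.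
by apply: continuous_comp; exact: bop_continuous.
Qed.

Definition bopM (A B : bop) : bop := Bop (bopM_subproof A B).

Lemma bopMA : associative bopM. Proof. by move=> A B C; exact/bopP. Qed.
Lemma bop1M : left_id bop1 bopM. Proof. by move=> A; exact/bopP. Qed.
Lemma bopM1 : right_id bop1 bopM. Proof. by move=> A; exact/bopP. Qed.
Lemma bopMDl : left_distributive bopM +%R.
Proof. by move=> A B C; exact/bopP. Qed.
Lemma bopMDr : right_distributive bopM +%R.
Proof. by move=> A B C; apply/bopP => x /=; exact: linearD. Qed.

HB.instance Definition _ :=
  GRing.Zmodule_isPzRing.Build bop bopMA bop1M bopM1 bopMDl bopMDr.

Lemma ip_bound (x y : G) : `|ip x y| <= `|x| * `|y|.
Proof.
have [->|y0] := eqVneq y 0; first by rewrite linear0r !normr0 mulr0.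
have ny : 0 < `|y| by rewrite normr_gt0.
pose a := ip x y / ip y y.
have ip0 : ip (x - a *: y) y = 0.
  by rewrite linearBl linearZl_LR /= divfK ?subrr // ip_norm expf_neq0 // gt_eqF.
have Ex : ip x x = ip (x - a *: y) (x - a *: y) + `|a| ^+ 2 * ip y y.
  have {1 2}-> : x = (x - a *: y) + a *: y by rewrite subrK.
  by rewrite hnormDd /= ?dnormZ // linearZr_LR /= ip0 mulr0.
rewrite -(@ler_pXn2r _ 2) ?nnegrE ?mulr_ge0 //.
rewrite exprMn -[X in _ <= X * _](ip_norm x) Ex mulrDl.
have -> : `|a| ^+ 2 * ip y y * `|y| ^+ 2 = `|ip x y| ^+ 2.
  rewrite /a normf_div ip_norm normrX normr_id expr_div_n.
  by rewrite -mulrA -expr2 divfK // !expf_neq0 // gt_eqF.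
by rewrite lerDr mulr_ge0 // exprn_ge0.
Qed.

Lemma rank1_subproof (e : G) : (fun x => ip x e *: e) \in bounded_op.
Proof.
rewrite inE.
have lf : linear (fun x => ip x e *: e).
  by move=> a x y; rewrite linearPl /= scalerDl scalerA.
split=> //.
pose f : {linear G -> G} :=
  HB.pack (fun x => ip x e *: e) (GRing.isLinear.Build R[i] G G _ _ lf).
apply: (@bounded_linear_continuous R[i] G G f).
apply/(@linear_boundedP R[i] G G); near=> r => x.
rewrite /f /= normrZ (le_trans (ler_wpM2r _ (ip_bound x e))) //.
rewrite -mulrA mulrC ler_wpM2r //; near: r.
by apply: nbhs_pinfty_ge; rewrite rpredM ?normr_real.
Unshelve. all: by end_near. Qed.

(* ee^* : g |-> e <e, g> *)
Definition rank1 (e : G) : bop := Bop (rank1_subproof e).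

End bounded_operators.

Section operator_algebra.
Context (R : realType) (G : hilbertType R).
Implicit Types (A B X : bop G) (C D : set (bop G)).

Definition is_adjoint A B := forall x y : G, ip (A x) y = ip x (B y).

Definition selfadjoint A := is_adjoint A A.

Definition op_bracket A B := A * B - B * A.

Definition commutant C : set (bop G) :=
  [set B | forall A, C A -> GRing.comm A B].

Definition scalar_ops : set (bop G) := [set a *: (1 : bop G) | a in [set: R[i]]].

Definition commutative_set C := forall A B, C A -> C B -> GRing.comm A B.

Definition subalgebra C :=
  [/\ C 0, forall (a : R[i]) A B, C A -> C B -> C (a *: A + B)
    & forall A B, C A -> C B -> C (A * B)].

(* The sets [set B | forall p, p \in s -> `|<p.2, (B - A) p.1>| < eps] form a
   basis of neighbourhoods of A in the weak operator topology. *)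
Definition wot_closed C := forall A,
  (forall (s : seq (G * G)) (eps : R), 0 < eps ->
     exists2 B, C B & forall p, p \in s -> `|ip ((B - A) p.1) p.2| < eps%:C) ->
  C A.

Definition von_neumann_algebra C :=
  [/\ subalgebra C, C 1, forall A, C A -> exists2 B, C B & is_adjoint A B
    & wot_closed C].

Definition masa C :=
  [/\ von_neumann_algebra C, commutative_set C
    & forall D, subalgebra D -> commutative_set D -> C `<=` D -> D `<=` C].

(* For a linear subspace C, this says that dim C <= n. *)
Definition dim_le (n : nat) C :=
  exists v : 'I_n -> bop G, (forall i, C (v i)) /\
    forall X, C X -> exists a : 'I_n -> R[i], X = \sum_i a i *: v i.

(* Over the complex field, [0 <= z] says that z is a nonnegative real, so a
   positive operator is self-adjoint. *)
Definition positive_op A := forall x : G, 0 <= ip (A x) x.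

Definition op_le A B := positive_op (B - A).

(* positivity of an n x n matrix over B(G) as an operator on the direct sum of
   n copies of G *)
Definition positive_opmx n (X : 'M[bop G]_n) :=
  forall x : 'I_n -> G, 0 <= \sum_i \sum_j ip (X i j (x j)) (x i).

Definition completely_positive (Phi : bop G -> bop G) :=
  forall n (X : 'M[bop G]_n), positive_opmx X -> positive_opmx (map_mx Phi X).

Definition op_lub D X :=
  (forall A, D A -> op_le A X) /\
  (forall B, (forall A, D A -> op_le A B) -> op_le X B).

Definition op_directed D :=
  D !=set0 /\ forall A B, D A -> D B ->
    exists E, [/\ D E, op_le A E & op_le B E].

(* A positive map is normal if it preserves the suprema of bounded increasing
   nets of self-adjoint operators. *)
Definition normal_map (Phi : bop G -> bop G) := forall D X,
  D `<=` selfadjoint -> op_directed D -> op_lub D X -> op_lub (Phi @` D) (Phi X).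

Definition markov_map (Phi : bop G -> bop G) :=
  [/\ linear Phi, completely_positive Phi, Phi 1 = 1 & normal_map Phi].

(* Only the values T t with 0 <= t matter. *)
Definition markov_semigroup (T : R -> bop G -> bop G) :=
  [/\ forall t, 0 <= t -> markov_map (T t), T 0 =1 id
    & forall s t, 0 <= s -> 0 <= t -> T (s + t) =1 T s \o T t].

(* The operator norm of A is at most k. *)
Definition opnorm_le A (k : R) := forall x : G, `|A x| <= k%:C * `|x|.

(* The norm of Phi as an operator on the Banach space B(G) is at most c. *)
Definition mapnorm_le (Phi : bop G -> bop G) (c : R) :=
  forall X k, opnorm_le X k -> opnorm_le (Phi X) (c * k).

(* ||T_t - id|| --> 0 as t --> 0+ *)
Definition uniformly_continuous (T : R -> bop G -> bop G) :=
  forall eps : R, 0 < eps ->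
    \forall t \near 0^'+, mapnorm_le (fun X => T t X - X) eps.

(* ||(T_t - id) / t - L|| --> 0 as t --> 0+ *)
Definition generator_of (T : R -> bop G -> bop G) (L : bop G -> bop G) :=
  forall eps : R, 0 < eps ->
    \forall t \near 0^'+,
      mapnorm_le (fun X => t^-1%:C *: (T t X - X) - L X) eps.

Definition generator_invariant (L : bop G -> bop G) C := forall X, C X -> C (L X).

Definition semigroup_invariant (T : R -> bop G -> bop G) C :=
  forall t, 0 <= t -> forall X, C X -> C (T t X).

Definition Lgen (e : G) (H X : bop G) : bop G :=
  let P := rank1 e in
  P * X * P - 2^-1 *: (P * X + X * P) + 'i%C *: op_bracket H X.

End operator_algebra.

Arguments scalar_ops {R} G.

(* Main.v *)
Require Import Defs.
From HB Require Import structures.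
From mathcomp Require Import all_boot all_order all_algebra.
From mathcomp Require Import sesquilinear complex.
From mathcomp Require Import all_classical reals topology normedtype.
From mathcomp Require Import sequences exp ring lra.

Set Implicit Arguments.
Unset Strict Implicit.
Unset Printing Implicit Defensive.

Import Order.TTheory GRing.Theory Num.Theory.
Import numFieldNormedType.Exports.

Local Open Scope classical_set_scope.
Local Open Scope ring_scope.

(** Write P for the projection onto the line of e.  Two things have to be proved:
    that an invariant commutative algebra is at most two-dimensional, and that
    the generator exponentiates to a semigroup of normal completely positive
    maps.

    Invariant algebras ([invariant_dichotomy]).  Let C be commutative and
    invariant.  For X in C the dissipation L(XX) - L(X)X - XL(X) = -[P,X]^2 lies
    in C.  If X is selfadjoint and X e = a e + f with f orthogonal to e, this
    operator is |f|^2 ee* + ff* ([dissipation_rank2]), so when f is nonzero C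
    contains the projection Q onto the span of e and f.  As PQ = QP = P, the
    operator L(Q) is i[H,Q]; it lies in C, hence commutes with Q, and a
    commutator [H,Q] that commutes with the selfadjoint Q vanishes
    ([bracket_comm_eq0], a quantitative form of the Kleinecke-Shirokov theorem).
    So Q commutes with H and P, therefore Q = 1 and the whole space is the span
    of e and f; an element of C is then determined by its value at e, which
    leaves two dimensions.  If f is zero for all selfadjoint X in C, these X
    commute with P, so L(X) = i[H,X] is in C and the same argument gives
    [H,X] = 0, so that X is scalar.  In dimension at least three only the scalar
    case remains, and the scalars are properly contained in the commutative
    algebra spanned by 1 and P ([masa_not_invariant]).

    The semigroup ([Lgen_semigroup]).  The powers (1 + tL/2^n)^(2^n) converge
    geometrically in the norm of maps on B(G), and their limit T_t inherits the
    semigroup law because the factors for different times commute and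
    (1 + sL/N)(1 + tL/N) differs from 1 + (s+t)L/N by O(1/N^2) only.  With
    K = iH - P/2 one has L(X) = PXP + KX + XK*, so 1 + tL/N is also within
    O(1/N^2) of X |-> (1 + tK/N) X (1 + tK/N)* + (t/N) PXP.  Powers of the latter
    are finite sums of conjugations, and T_t is their limit in norm, whence
    complete positivity.  Normality passes to norm limits as soon as suprema of
    directed families of operators are known to be weak limits; this is
    [op_lub_form].

    Existence of H and e ([trivial_commutant_pair]).  Orthonormalize a sequence
    that determines bounded operators, and let H be diagonal with distinct
    eigenvalues and e have no vanishing coordinate: an operator commuting with H
    is diagonal, and the eigenvector e makes all its diagonal entries equal. *)

(** * Norms and scalars *)

Section RealNorm.
Context (R : realType) (V : normedZmodType R[i]).
Implicit Types x y : V.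

(** The norm of a complex normed space takes values in the complex field; its
    real part carries all the information, and real arithmetic applies to it. *)
Definition rnorm x : R := complex.Re `|x|.

Lemma rnormE x : ((rnorm x)%:C)%C = `|x|.
Proof. by rewrite /rnorm RRe_real // normr_real. Qed.

Lemma rnorm_ge0 x : 0 <= rnorm x.
Proof. by rewrite -lecR rnormE rmorph0. Qed.

Lemma rnorm0 : rnorm 0 = 0.
Proof. by rewrite /rnorm normr0. Qed.

Lemma rnorm0_eq0 x : rnorm x = 0 -> x = 0.
Proof. by move=> x0; apply/normr0_eq0; rewrite -rnormE x0. Qed.

Lemma rnorm_gt0 x : (0 < rnorm x) = (x != 0).
Proof. by rewrite -ltcR rnormE rmorph0 normr_gt0. Qed.

Lemma rnormD x y : rnorm (x + y) <= rnorm x + rnorm y.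
Proof. by rewrite -lecR rmorphD /= !rnormE ler_normD. Qed.

Lemma rnormN x : rnorm (- x) = rnorm x.
Proof. by rewrite /rnorm normrN. Qed.

Lemma rnormB x y : rnorm (x - y) <= rnorm x + rnorm y.
Proof. by rewrite (le_trans (rnormD _ _))// rnormN. Qed.

Lemma rnorm_distC x y : rnorm (x - y) = rnorm (y - x).
Proof. by rewrite /rnorm distrC. Qed.

Lemma rnorm_sum (I : Type) (r : seq I) (P : pred I) (F : I -> V) :
  rnorm (\sum_(i <- r | P i) F i) <= \sum_(i <- r | P i) rnorm (F i).
Proof.
elim/big_ind2 : _ => [|x a y b xa yb|//]; first by rewrite rnorm0.
by rewrite (le_trans (rnormD _ _))// lerD.
Qed.

End RealNorm.

Section ComplexNumbers.
Context (R : realType).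
Implicit Types (z w : R[i]).

Lemma rnormM z w : rnorm (z * w) = rnorm z * rnorm w.
Proof. by apply: complexI; rewrite rmorphM /= !rnormE normrM. Qed.

Lemma rnorm_real (a : R) : rnorm (a%:C)%C = `|a|.
Proof. by rewrite /rnorm normc_def /= expr0n addr0 sqrtr_sqr. Qed.

Lemma rnorm1 : rnorm (1 : R[i]) = 1.
Proof. by rewrite -[1 : R[i]]/((1 : R)%:C)%C rnorm_real normr1. Qed.

Lemma rnorm_i : rnorm ('i%C : R[i]) = 1.
Proof. by rewrite /rnorm normc_def /= expr0n add0r expr1n sqrtr1. Qed.

Lemma conj_i : ('i%C : R[i])^* = - 'i%C.
Proof. by apply/eqP; rewrite eq_complex /= oppr0 !eqxx. Qed.

Lemma conj_RC (a : R) : ((a%:C)%C : R[i])^* = (a%:C)%C.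
Proof. exact: conjc_real. Qed.

Lemma i_neq0 : ('i%C : R[i]) != 0.
Proof. by rewrite eq_complex /= oner_eq0 andbF. Qed.

Lemma mul_ii : 'i%C * 'i%C = -1 :> R[i].
Proof.
by apply/eqP; rewrite eq_complex /= !mul0r !mulr0 !mul1r sub0r addr0 oppr0 !eqxx.
Qed.

Lemma rnorm_Re z : `|complex.Re z| <= rnorm z.
Proof.
rewrite /rnorm normc_def /= -sqrtr_sqr ler_sqrt ?addr_ge0 ?sqr_ge0//.
by rewrite lerDl sqr_ge0.
Qed.

Lemma rnorm_Im z : `|complex.Im z| <= rnorm z.
Proof.
rewrite /rnorm normc_def /= -sqrtr_sqr ler_sqrt ?addr_ge0 ?sqr_ge0//.
by rewrite lerDr sqr_ge0.
Qed.

Lemma ReD z w : complex.Re (z + w) = complex.Re z + complex.Re w.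
Proof. by case: z w => a b []. Qed.

Lemma ReN z : complex.Re (- z) = - complex.Re z.
Proof. by case: z. Qed.

Lemma RC_eq0 (a : R) : ((a%:C)%C == 0 :> R[i]) = (a == 0).
Proof. by rewrite eq_complex /= eqxx andbT. Qed.

Lemma pow2_small (c e : R) : 0 < e -> exists n, c / 2 ^+ n < e.
Proof.
move=> e0; exists (Num.bound (c / e)).
rewrite ltr_pdivrMr ?exprn_gt0// [e * _]mulrC -ltr_pdivrMr//.
have [c0|c0] := ltP c 0.
  by rewrite (@lt_trans _ _ 0)// ?exprn_gt0// pmulr_llt0// invr_gt0.
apply: lt_trans (archi_boundP _) _; first by rewrite divr_ge0// ltW.
by rewrite -natrX ltr_nat ltn_expl.
Qed.

Lemma real_small0 (a c : R) : (forall n, `|a| <= c / 2 ^+ n) -> a = 0.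
Proof.
move=> ac; apply/eqP; rewrite -normr_eq0 eq_le normr_ge0 andbT leNgt.
by apply/negP => /(pow2_small c)[n]; rewrite ltNge ac.
Qed.

(** Limits are taken throughout along explicit rates c / 2^n; here the imaginary
    part of z is squeezed to 0. *)
Lemma complex_lim_ge0 z c :
  (forall n, exists2 w : R[i], 0 <= w & rnorm (z - w) <= c / 2 ^+ n) -> 0 <= z.
Proof.
move=> zw; rewrite lecE /=; apply/andP; split.
  apply/eqP; apply: (@real_small0 _ c) => n; have [w w0 zwn] := zw n.
  apply: le_trans zwn; apply: le_trans (rnorm_Im _).
  by case: (z) (w) w0 => a b [a' b']; rewrite lecE /= => /andP[/eqP -> _]; rewrite subr0.
rewrite leNgt; apply/negP => z0.
have : complex.Re z = 0; last by move=> z00; rewrite z00 ltxx in z0.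
apply: (@real_small0 _ c) => n; have [w w0 zwn] := zw n.
apply: le_trans zwn; apply: le_trans (rnorm_Re _).
case: (z) (w) z0 w0 => a b [a' b'] /= z0; rewrite lecE /= => /andP[_ a'0].
rewrite !ler0_norm ?lerN2; lra.
Qed.

End ComplexNumbers.

(** * Convergence in the Hilbert space *)

Section HilbertNorm.
Context (R : realType) (G : hilbertType R).
Implicit Types (x y z : G).

Lemma rnormZ (a : R[i]) x : rnorm (a *: x) = rnorm a * rnorm x.
Proof. by apply: complexI; rewrite rmorphM /= !rnormE normrZ. Qed.

Lemma rnorm_ip x y : rnorm (ip x y) <= rnorm x * rnorm y.
Proof. by rewrite -lecR rmorphM /= !rnormE ip_bound. Qed.

Lemma ip_rnorm x : ip x x = ((rnorm x ^+ 2)%:C)%C.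
Proof. by rewrite rmorphXn /= rnormE ip_norm. Qed.

Lemma ipC x y : ip x y = (ip y x)^*.
Proof. by rewrite (@hermC _ _ _ _ ip) expr0 mul1r. Qed.

Lemma ipZl a x y : ip (a *: x) y = a * ip x y.
Proof. exact: linearZl_LR. Qed.

Lemma ipZr a x y : ip x (a *: y) = a^* * ip x y.
Proof. exact: linearZr_LR. Qed.

Lemma ipDl x y z : ip (x + y) z = ip x z + ip y z.
Proof. exact: linearDl. Qed.

Lemma ipDr x y z : ip x (y + z) = ip x y + ip x z.
Proof. exact: linearDr. Qed.

Lemma ipNl x y : ip (- x) y = - ip x y.
Proof. exact: linearNl. Qed.

Lemma ipNr x y : ip x (- y) = - ip x y.
Proof. exact: linearNr. Qed.

Lemma ip0l x : ip 0 x = 0. Proof. exact: linear0l. Qed.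

Lemma ip0r x : ip x 0 = 0. Proof. exact: linear0r. Qed.

Lemma ip_suml n (v : 'I_n -> G) y : ip (\sum_i v i) y = \sum_i ip (v i) y.
Proof. by apply: (big_morph (fun x => ip x y)) => [? ?|]; [exact: ipDl|exact: ip0l]. Qed.

(** The form [ip] is accessed through coercions of bilinear structures, which
    block later rewriting; these copies of the linearity rules keep it folded. *)
Definition ipE := (ipDl, ipDr, ipNl, ipNr, ip0l, ip0r, ipZl, ipZr).

Lemma small_eq0 x (c : R) : (forall n, rnorm x <= c / 2 ^+ n) -> x = 0.
Proof.
by move=> xc; apply/rnorm0_eq0/real_small0 => n; rewrite ger0_norm ?rnorm_ge0.
Qed.

(** The only use of completeness of the Hilbert space. *)
Lemma geometric_cauchy (u : nat -> G) (c : R) :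
  (forall n, rnorm (u n.+1 - u n) <= c / 2 ^+ n) ->
  exists l, forall n, rnorm (l - u n) <= 2 * c / 2 ^+ n.
Proof.
move=> uc.
have E k : (2 : R) ^+ k > 0 by rewrite exprn_gt0.
have c0 : 0 <= c by have := uc 0%N; rewrite expr0 divr1; apply: le_trans; rewrite rnorm_ge0.
(* The tail of the geometric series beyond n is exactly 2c / 2^n. *)
have um n m : rnorm (u (n + m)%N - u n) <= 2 * c / 2 ^+ n - 2 * c / 2 ^+ (n + m).
  elim: m => [|m IH]; first by rewrite addn0 !subrr rnorm0.
  rewrite addnS -[_ - u n](subrKA (u (n + m)%N)).
  rewrite (le_trans (rnormD _ _))//; have := uc (n + m)%N.
  have -> : c / 2 ^+ (n + m) = 2 * c / 2 ^+ (n + m) - 2 * c / 2 ^+ (n + m).+1.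
    by rewrite (exprS _ (n + m)); field; rewrite gt_eqF.
  by move: IH; lra.
have um' n m : rnorm (u (n + m)%N - u n) <= 2 * c / 2 ^+ n.
  by rewrite (le_trans (um _ _))// gerBl divr_ge0 ?mulr_ge0 ?exprn_ge0.
have cu : cvg (u @ \oo).
  apply/cauchy_cvgP/cauchy_exP => /= e e0.
  have [e' e'0 e'e] : exists2 e', 0 < e' & (e'%:C)%C = e.
    exists (complex.Re e); last by rewrite RRe_real// gtr0_real.
    by rewrite -ltcR RRe_real// gtr0_real.
  have [N NP] := pow2_small (4 * c) e'0.
  exists (u N), N => // n /= /subnKC <-.
  rewrite -ball_normE /ball_ /= -e'e -rnormE ltcR rnorm_distC.
  apply: le_lt_trans (um' _ _) _.
  apply: le_lt_trans NP; rewrite ler_pM2r ?invr_gt0//; lra.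
exists (lim (u @ \oo)) => n.
rewrite leNgt; apply/negP => ln.
set l := lim _ in ln.
pose d := rnorm (l - u n) - 2 * c / 2 ^+ n.
have d0 : 0 < (d%:C)%C by rewrite -[0]/((0 : R)%:C)%C ltcR subr_gt0.
have /cvgrPdist_lt /(_ _ d0) [M _ MP] := cu.
have := MP (n + M)%N; rewrite /= leq_addl => /(_ isT).
rewrite -rnormE ltcR ltNge => /negP; apply.
rewrite /d lerBlDr -(subrKA (u (n + M)%N)).
by rewrite (le_trans (rnormD _ _))// lerD.
Qed.

End HilbertNorm.

(** * Norm estimates for operators and for maps on B(G) *)

Section OperatorNorm.
Context (R : realType) (G : hilbertType R).
Implicit Types (A B X Y : bop G) (x y : G) (k : R) (Phi Psi : bop G -> bop G).

Lemma bopD A B x : (A + B) x = A x + B x. Proof. by []. Qed.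
Lemma bopN A x : (- A) x = - A x. Proof. by []. Qed.
Lemma bopB A B x : (A - B) x = A x - B x. Proof. by []. Qed.
Lemma bopZ a A x : (a *: A) x = a *: A x. Proof. by []. Qed.
Lemma bopME A B x : (A * B) x = A (B x). Proof. by []. Qed.
Lemma bop1E x : (1 : bop G) x = x. Proof. by []. Qed.
Lemma bop0E x : (0 : bop G) x = 0. Proof. by []. Qed.

Lemma bopDr A x y : A (x + y) = A x + A y. Proof. exact: linearD. Qed.
Lemma bopNr A x : A (- x) = - A x. Proof. exact: linearN. Qed.
Lemma bopZr A a x : A (a *: x) = a *: A x. Proof. exact: linearZ. Qed.
Lemma bop0r A : A 0 = 0. Proof. exact: linear0. Qed.

Definition bopE := (bopD, bopN, bopZ, bopME, bop1E, bop0E, bopDr, bopNr, bopZr, bop0r).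

Lemma bop_sumr A n (v : 'I_n -> G) : A (\sum_i v i) = \sum_i A (v i).
Proof. exact: (big_morph A (bopDr A) (bop0r A)). Qed.

Lemma bop_suml n (F : 'I_n -> bop G) x : (\sum_i F i) x = \sum_i F i x.
Proof. exact: (big_morph (fun A : bop G => A x)). Qed.

Lemma bopZAl a A B : (a *: A) * B = a *: (A * B).
Proof. exact/bopP. Qed.

Lemma bopZAr a A B : A * (a *: B) = a *: (A * B).
Proof. by apply/bopP => x; rewrite !bopE. Qed.

Lemma bopNAl A B : (- A) * B = - (A * B).
Proof. exact/bopP. Qed.

Lemma bopNAr A B : A * (- B) = - (A * B).
Proof. by apply/bopP => x; rewrite !bopE. Qed.

Lemma opnormP A k : opnorm_le A k <-> forall x, rnorm (A x) <= k * rnorm x.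
Proof.
by split=> Ak x; have := Ak x; rewrite -lecR rmorphM /= !rnormE.
Qed.

(** A negative bound is possible only on the zero space. *)
Lemma opnorm_lt0 A k x : opnorm_le A k -> k < 0 -> x = 0.
Proof.
move=> /opnormP/(_ x) Ax k0; apply: rnorm0_eq0.
have := rnorm_ge0 (A x); have := rnorm_ge0 x.
by move=> x0 Ax0; apply/eqP; rewrite eq_le x0 andbT; nra.
Qed.

Lemma opnorm_le_trans A k k' : k <= k' -> opnorm_le A k -> opnorm_le A k'.
Proof.
move=> kk' /opnormP Ak; apply/opnormP => x; apply: le_trans (Ak x) _.
by rewrite ler_wpM2r// rnorm_ge0.
Qed.

Lemma opnormD A B k k' : opnorm_le A k -> opnorm_le B k' -> opnorm_le (A + B) (k + k').
Proof.
move=> /opnormP Ak /opnormP Bk; apply/opnormP => x; rewrite bopE mulrDl.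
by apply: le_trans (rnormD _ _) _; rewrite lerD.
Qed.

Lemma opnormN A k : opnorm_le A k -> opnorm_le (- A) k.
Proof. by move=> /opnormP Ak; apply/opnormP => x; rewrite bopE rnormN. Qed.

Lemma opnormB A B k k' : opnorm_le A k -> opnorm_le B k' -> opnorm_le (A - B) (k + k').
Proof. by move=> Ak Bk; apply: opnormD => //; exact: opnormN. Qed.

Lemma opnormZ a A k : opnorm_le A k -> opnorm_le (a *: A) (rnorm a * k).
Proof.
move=> /opnormP Ak; apply/opnormP => x; rewrite bopE rnormZ -mulrA.
by rewrite ler_wpM2l// rnorm_ge0.
Qed.

Lemma opnormM A B k k' : 0 <= k ->
  opnorm_le A k -> opnorm_le B k' -> opnorm_le (A * B) (k * k').
Proof.
move=> k0 /opnormP Ak /opnormP Bk; apply/opnormP => x; rewrite bopE.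
by apply: le_trans (Ak _) _; rewrite -mulrA ler_wpM2l.
Qed.

Lemma opnorm0 k : 0 <= k -> opnorm_le (0 : bop G) k.
Proof. by move=> k0; apply/opnormP => x; rewrite rnorm0 mulr_ge0// rnorm_ge0. Qed.

Lemma opnorm_ex A : exists2 k, 0 <= k & opnorm_le A k.
Proof.
have /linear_bounded_continuous/linear_boundedP := @bop_continuous _ _ A.
move=> [M [Mreal MP]].
exists (Num.max 0 (complex.Re M) + 1).
  by rewrite addr_ge0// le_max lexx.
move=> x; apply: MP; rewrite -(RRe_real Mreal) ltcR.
by rewrite (le_lt_trans (y := Num.max 0 (complex.Re M)))// ?le_max ?lexx ?orbT// ltrDl.
Qed.

Lemma opnorm_small0 A c : (forall n, opnorm_le A (c / 2 ^+ n)) -> A = 0.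
Proof.
move=> Ac; apply/bopP => x; apply: (@small_eq0 _ _ _ (c * rnorm x)) => n.
by have /opnormP/(_ x) := Ac n; rewrite mulrAC.
Qed.

Lemma opnorm_lim_uniq A B c : (forall n, exists Y,
  opnorm_le (A - Y) (c / 2 ^+ n) /\ opnorm_le (B - Y) (c / 2 ^+ n)) -> A = B.
Proof.
move=> ABc; apply/subr0_eq/(@opnorm_small0 _ (c + c)) => n.
have [Y [AY BY]] := ABc n; rewrite -(subrKA Y A) -[Y - B]opprB mulrDl.
exact: opnormB.
Qed.

(** Completeness of B(G), by pointwise limits; the limit is bounded because it
    stays within 2c of the first term. *)
Lemma geometric_bop (X : nat -> bop G) c :
  (forall n, opnorm_le (X n.+1 - X n) (c / 2 ^+ n)) ->
  exists Y, forall n, opnorm_le (Y - X n) (2 * c / 2 ^+ n).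
Proof.
move=> Xc.
have /choice[f fP] : forall x, exists l, forall n,
    rnorm (l - X n x) <= 2 * (c * rnorm x) / 2 ^+ n.
  move=> x; apply: geometric_cauchy => n; have /opnormP/(_ x) := Xc n.
  by rewrite mulrAC.
have lf : linear f.
  move=> a x y; apply/subr0_eq.
  pose d := 2 * (c * rnorm (a *: x + y))
    + rnorm a * (2 * (c * rnorm x)) + 2 * (c * rnorm y).
  apply: (@small_eq0 _ _ _ d) => n.
  have -> : f (a *: x + y) - (a *: f x + f y) =
      (f (a *: x + y) - X n (a *: x + y)) - a *: (f x - X n x) - (f y - X n y).
    rewrite (bop_linear (X n)) scalerBr !opprD !opprK !addrA.
    by rewrite [RHS](ACl ((((((1*4)*6)*5)*2)*7)*3))%AC /= !addrK.
  rewrite /d [leRHS]mulrDl [X in _ <= X + _]mulrDl.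
  apply: le_trans (rnormB _ _) _; apply: lerD; last exact: fP.
  apply: le_trans (rnormB _ _) _; apply: lerD; first exact: fP.
  by rewrite rnormZ -[leRHS]mulrA -[in leRHS]mulrA ler_wpM2l ?rnorm_ge0// mulrA.
have cf : continuous f.
  pose F : {linear G -> G} := HB.pack f (GRing.isLinear.Build R[i] G G _ _ lf).
  apply: (@bounded_linear_continuous R[i] G G F); apply/linear_boundedP.
  have [k k0 /opnormP Xk] := opnorm_ex (X 0%N).
  exists ((k + 2 * c)%:C)%C; split; first by rewrite complex_real.
  move=> r kr x; rewrite /F /= -[X in X <= _]rnormE.
  apply: (@le_trans _ _ ((k + 2 * c)%:C * `|x|)%C); last first.
    by rewrite ler_wpM2r// ltW.
  rewrite -rnormE -rmorphM /= lecR.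
  have -> : f x = X 0%N x + (f x - X 0%N x) by rewrite addrC subrK.
  apply: le_trans (rnormD _ _) _; rewrite mulrDl lerD//.
  by have := fP x 0%N; rewrite expr0 divr1 mulrA.
have fb : f \in @bounded_op R G by rewrite inE.
exists (Bop fb) => n; apply/opnormP => x.
by apply: le_trans (fP x n) _; rewrite mulrA mulrAC.
Qed.

Lemma mapnormP Phi c :
  (forall X k, 0 <= k -> opnorm_le X k -> opnorm_le (Phi X) (c * k)) ->
  mapnorm_le Phi c.
Proof.
move=> Pc X k Xk; have [|k0] := leP 0 k; first by move=> ?; exact: Pc.
by apply/opnormP => x; rewrite (opnorm_lt0 x Xk k0) linear0 rnorm0 mulr0.
Qed.

Lemma mapnorm_trans Phi c c' : c <= c' -> mapnorm_le Phi c -> mapnorm_le Phi c'.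
Proof.
move=> cc' Pc; apply: mapnormP => X k k0 /Pc; apply: opnorm_le_trans.
by rewrite ler_wpM2r.
Qed.

Lemma mapnormD Phi Psi c c' : mapnorm_le Phi c -> mapnorm_le Psi c' ->
  mapnorm_le (fun X => Phi X + Psi X) (c + c').
Proof.
by move=> Pc Qc X k Xk; rewrite mulrDl; apply: opnormD; [exact: Pc|exact: Qc].
Qed.

Lemma mapnormZ a Phi c : mapnorm_le Phi c ->
  mapnorm_le (fun X => a *: Phi X) (rnorm a * c).
Proof. by move=> Pc X k Xk; rewrite -mulrA; apply: opnormZ; exact: Pc. Qed.

Lemma mapnorm_comp Phi Psi c c' : mapnorm_le Phi c -> mapnorm_le Psi c' ->
  mapnorm_le (fun X => Phi (Psi X)) (c * c').
Proof. by move=> Pc Qc X k Xk; rewrite -mulrA; apply/Pc/Qc. Qed.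

Lemma mapnorm_id : mapnorm_le (@id (bop G)) 1.
Proof. by move=> X k; rewrite mul1r. Qed.

Lemma mapnorm_iter Phi c n : mapnorm_le Phi c -> mapnorm_le (iter n Phi) (c ^+ n).
Proof.
move=> Pc; elim: n => [|n IH]; first by rewrite expr0; exact: mapnorm_id.
by rewrite exprS; exact: mapnorm_comp.
Qed.

Lemma eq_mapnorm Phi Psi c : Phi =1 Psi -> mapnorm_le Phi c -> mapnorm_le Psi c.
Proof. by move=> PQ Pc X k Xk; rewrite -PQ; exact: Pc. Qed.

Lemma bop_mapB Phi X Y : linear Phi -> Phi (X - Y) = Phi X - Phi Y.
Proof. by move=> /(_ (-1) Y X); rewrite !scaleN1r ![- _ + _]addrC. Qed.

(** The telescoping sum a^n - b^n = sum of a^(n-1-k) (a - b) b^k. *)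
Lemma mapnorm_iterB Phi Psi q d n : linear Phi -> 1 <= q -> 0 <= d ->
  mapnorm_le Phi q -> mapnorm_le Psi q ->
  mapnorm_le (fun X => Phi X - Psi X) d ->
  mapnorm_le (fun X => iter n Phi X - iter n Psi X) (n%:R * q ^+ n * d).
Proof.
move=> lP q1 d0 Pq Qq PQ.
elim: n => [|n IH].
  rewrite !mul0r; apply: mapnormP => X k k0 _ /=; rewrite subrr.
  by rewrite mul0r; exact: opnorm0.
apply: (@eq_mapnorm (fun X => Phi (iter n Phi X - iter n Psi X)
    + (Phi (iter n Psi X) - Psi (iter n Psi X)))).
  by move=> X; rewrite (bop_mapB _ _ lP) subrKA.
apply: (@mapnorm_trans _ (q * (n%:R * q ^+ n * d) + d * q ^+ n)); last first.
  apply: mapnormD; first exact: mapnorm_comp.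
  exact: (@mapnorm_comp (fun X => Phi X - Psi X) (iter n Psi) _ _ PQ (mapnorm_iter _ _)).
rewrite -natr1 !mulrDl mul1r exprS.
have qn : 1 <= q ^+ n by rewrite exprn_ege1.
have : d * q ^+ n <= q * q ^+ n * d by rewrite mulrC ler_wpM2r// ler_peMl// ?(le_trans _ qn).
by lra.
Qed.

(** Maps that agree up to O(1/N^2), and whose norms are at most exp(s/N), have
    N-th powers that agree up to O(1/N); here N = 2^n. *)
Lemma mapnorm_iter_pow2 Phi Psi s d n : linear Phi -> 0 <= d -> 0 <= s ->
  mapnorm_le Phi (expR (s / 2 ^+ n)) -> mapnorm_le Psi (expR (s / 2 ^+ n)) ->
  mapnorm_le (fun X => Phi X - Psi X) (d / (2 ^+ n * 2 ^+ n)) ->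
  mapnorm_le (fun X => iter (2 ^ n) Phi X - iter (2 ^ n) Psi X)
    (expR s * d / 2 ^+ n).
Proof.
move=> lP d0 s0 Ps Qs PQ.
have E : (2 : R) ^+ n != 0 by rewrite expf_neq0// pnatr_eq0.
have -> : expR s * d / 2 ^+ n =
    (2 ^ n)%:R * expR (s / 2 ^+ n) ^+ (2 ^ n) * (d / (2 ^+ n * 2 ^+ n)).
  by rewrite -expRM_natl natrX [2 ^+ n * (s / _)]mulrC divfK//; field.
apply: mapnorm_iterB => //.
  by rewrite -[X in X <= _]expR0 ler_expR divr_ge0// exprn_ge0.
by rewrite divr_ge0// mulr_ge0 ?exprn_ge0.
Qed.

End OperatorNorm.

(** * Exponential of a bounded generator by the Euler scheme *)

Section EulerScheme.
Context (R : realType) (G : hilbertType R) (L : bop G -> bop G) (l : R).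
Hypotheses (lL : linear L) (L_le : mapnorm_le L l) (l0 : 0 <= l).
Implicit Types (X Y : bop G) (s t : R).

Definition euler_step t n X : bop G := X + ((t / 2 ^+ n)%:C)%C *: L X.

Definition euler t n : bop G -> bop G := iter (2 ^ n) (euler_step t n).

Let pow2_gt0 n : (0 : R) < 2 ^+ n. Proof. by rewrite exprn_gt0. Qed.

Let L_D X Y : L (X + Y) = L X + L Y.
Proof. by have := lL 1 X Y; rewrite !scale1r. Qed.

Let L_Z a X : L (a *: X) = a *: L X.
Proof.
have L0 : L 0 = 0 by apply: (addrI (L 0)); rewrite -L_D !addr0.
by have := lL a X 0; rewrite L0 !addr0.
Qed.

Lemma euler_step_linear t n : linear (euler_step t n).
Proof.
move=> a X Y; rewrite /euler_step lL !scalerDr !scalerA addrACA.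
by rewrite [_ * a]mulrC.
Qed.

Lemma euler_linear t n : linear (euler t n).
Proof.
move=> a X Y; rewrite /euler; elim: (2 ^ n)%N => //= m ->.
exact: euler_step_linear.
Qed.

Lemma euler_step_norm t n : 0 <= t ->
  mapnorm_le (euler_step t n) (expR (t * l / 2 ^+ n)).
Proof.
move=> t0; apply: (@mapnorm_trans _ _ _ (1 + rnorm ((t / 2 ^+ n)%:C)%C * l)).
  apply: le_trans (expR_ge1Dx _); rewrite lerD2l rnorm_real.
  by rewrite ger0_norm; [rewrite mulrAC|rewrite divr_ge0// ltW].
by apply: mapnormD; [exact: mapnorm_id|exact: mapnormZ].
Qed.

Lemma euler_norm t n : 0 <= t -> mapnorm_le (euler t n) (expR (t * l)).
Proof.
move=> t0; have := mapnorm_iter (2 ^ n) (euler_step_norm n t0).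
by rewrite -expRM_natl natrX mulrC divfK// gt_eqF.
Qed.

(** The identity (1 + sL/N)(1 + tL/N) - (1 + (s + t)L/N) = stL^2/N^2, which also
    shows that the two factors commute. *)
Lemma euler_stepD s t n X :
  euler_step s n (euler_step t n X) - euler_step (s + t) n X =
  ((s / 2 ^+ n)%:C * (t / 2 ^+ n)%:C)%C *: L (L X).
Proof.
rewrite /euler_step L_D L_Z scalerDr scalerA mulrDl rmorphD /= scalerDl.
by rewrite [_ *: L X + _ *: L X]addrC !addrA [X + _ + _ + _ - _]addrAC subrr add0r.
Qed.

(** The same identity at s = t compares two consecutive step sizes. *)
Lemma euler_step_double t n X :
  euler_step t n.+1 (euler_step t n.+1 X) - euler_step t n X =
  ((t / 2 ^+ n.+1)%:C * (t / 2 ^+ n.+1)%:C)%C *: L (L X).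
Proof.
rewrite -euler_stepD; congr (_ - (_ + (_%:C)%C *: _)).
by rewrite exprS; field; rewrite gt_eqF.
Qed.

Let LL_le (a : R) : mapnorm_le (fun X => (a%:C)%C *: L (L X)) (`|a| * (l * l)).
Proof.
rewrite -(@rnorm_real _ a); apply: mapnormZ.
exact: mapnorm_comp.
Qed.

Lemma euler_cauchy t n : 0 <= t ->
  mapnorm_le (fun X => euler t n.+1 X - euler t n X)
    (expR (t * l) * ((t * l) ^+ 2 / 4) / 2 ^+ n).
Proof.
move=> t0.
have iter_double k (f : bop G -> bop G) X :
    iter k.*2 f X = iter k (fun X => f (f X)) X.
  by elim: k => //= k ->.
apply: (@eq_mapnorm _ _ (fun X =>
  iter (2 ^ n) (fun X => euler_step t n.+1 (euler_step t n.+1 X)) X - euler t n X)).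
  by move=> X; rewrite {2}/euler expnS mul2n iter_double.
apply: mapnorm_iter_pow2.
- move=> a X Y; rewrite !euler_step_linear.
  by [].
- by rewrite divr_ge0// sqr_ge0.
- exact: mulr_ge0.
- have -> : t * l / 2 ^+ n = t * l / 2 ^+ n.+1 + t * l / 2 ^+ n.+1.
    by rewrite exprS; field; rewrite gt_eqF.
  by rewrite expRD; apply: mapnorm_comp; exact: euler_step_norm.
- exact: euler_step_norm.
- apply: eq_mapnorm; first by move=> X; rewrite euler_step_double -rmorphM /=.
  apply: mapnorm_trans (LL_le _).
  rewrite ger0_norm; last by rewrite -expr2 sqr_ge0.
  by rewrite le_eqVlt; apply/orP; left; apply/eqP; rewrite exprS; field; rewrite gt_eqF.
Qed.

(** A map on B(G) has to be controlled for every norm bound of its argument at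
    once, whereas the limit below is chosen for one bound; uniqueness of limits
    reconciles the two. *)
Lemma euler_lim t : 0 <= t -> exists T : bop G -> bop G, forall n,
  mapnorm_le (fun X => T X - euler t n X) (expR (t * l) * ((t * l) ^+ 2 / 2) / 2 ^+ n).
Proof.
move=> t0; set c := expR _ * _.
have E X k : opnorm_le X k ->
    exists Y, forall n, opnorm_le (Y - euler t n X) (c / 2 ^+ n * k).
  move=> Xk.
  have [n|Y YP] := @geometric_bop _ _ (fun n => euler t n X)
    (expR (t * l) * ((t * l) ^+ 2 / 4) * k).
    by rewrite mulrAC; apply: euler_cauchy.
  exists Y => n; suff -> : c / 2 ^+ n * k =
      2 * (expR (t * l) * ((t * l) ^+ 2 / 4) * k) / 2 ^+ n by exact: YP.
  by rewrite /c; field; rewrite gt_eqF.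
have /choice[T TP] : forall X, exists Y, exists k,
    0 <= k /\ forall n, opnorm_le (Y - euler t n X) (c / 2 ^+ n * k).
  by move=> X; have [k k0 /E[Y YP]] := opnorm_ex X; exists Y, k.
exists T => n; apply: mapnormP => X k k0 /E[Y YP].
suff -> : T X = Y by exact: YP.
have [k' [k'0 Tk]] := TP X.
have c0 : 0 <= c by rewrite mulr_ge0 ?expR_ge0// divr_ge0// sqr_ge0.
apply: (@opnorm_lim_uniq _ _ _ _ (c * (k + k'))) => m; exists (euler t m X).
split; [apply: opnorm_le_trans (Tk m)|apply: opnorm_le_trans (YP m)].
  by rewrite mulrAC ler_wpM2r ?invr_ge0 ?(ltW (pow2_gt0 _))// ler_wpM2l// lerDr.
by rewrite mulrAC ler_wpM2r ?invr_ge0 ?(ltW (pow2_gt0 _))// ler_wpM2l// lerDl.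
Qed.

(** The family exp(tL), known only through its approximations. *)
Definition euler_limit (T : R -> bop G -> bop G) := forall t n, 0 <= t ->
  mapnorm_le (fun X => T t X - euler t n X)
    (expR (t * l) * ((t * l) ^+ 2 / 2) / 2 ^+ n).

Lemma euler_limit_ex : exists T, euler_limit T.
Proof.
have /choice[T TP] : forall t, exists T : bop G -> bop G, 0 <= t -> forall n,
    mapnorm_le (fun X => T X - euler t n X)
      (expR (t * l) * ((t * l) ^+ 2 / 2) / 2 ^+ n).
  move=> t; have [/euler_lim[T TP]|t0] := leP 0 t; first by exists T.
  by exists id.
by exists T => t n t0; exact: TP.
Qed.

Section EulerLimit.
Variable T : R -> bop G -> bop G.
Hypothesis T_lim : euler_limit T.

Lemma euler_limit_small t : 0 <= t ->
  exists2 c, 0 <= c & forall X k, 0 <= k -> opnorm_le X k ->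
    forall n, opnorm_le (T t X - euler t n X) (c * k / 2 ^+ n).
Proof.
move=> t0; exists (expR (t * l) * ((t * l) ^+ 2 / 2)).
  by rewrite mulr_ge0 ?expR_ge0// divr_ge0// sqr_ge0.
by move=> X k k0 Xk n; rewrite mulrAC; exact: T_lim.
Qed.

Lemma euler_limit_linear t : 0 <= t -> linear (T t).
Proof.
move=> t0 a X Y; have [c c0 Tc] := euler_limit_small t0.
have [kX kX0 /(Tc _ _ kX0) TX] := opnorm_ex X.
have [kY kY0 /(Tc _ _ kY0) TY] := opnorm_ex Y.
have [k k0 /(Tc _ _ k0) TXY] := opnorm_ex (a *: X + Y).
set u := c * k; set v := rnorm a * (c * kX) + c * kY.
have u0 : 0 <= u by rewrite mulr_ge0.
have v0 : 0 <= v by rewrite addr_ge0// !mulr_ge0// rnorm_ge0.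
apply: (@opnorm_lim_uniq _ _ _ _ (u + v)) => n; exists (euler t n (a *: X + Y)).
have i0 : 0 <= (2 ^+ n)^-1 :> R by rewrite invr_ge0 ltW.
split; first by apply: opnorm_le_trans (TXY n); rewrite ler_wpM2r// lerDl.
rewrite euler_linear opprD addrACA -scalerBr.
apply: (@opnorm_le_trans _ _ _ (v / 2 ^+ n)); first by rewrite ler_wpM2r// lerDr.
rewrite /v mulrDl; apply: opnormD; last exact: TY.
by rewrite -mulrA; apply: opnormZ.
Qed.

Lemma euler_limit0 X : T 0 X = X.
Proof.
have /euler_limit_small[c c0 Tc] := lexx (0 : R).
have [k k0 /(Tc _ _ k0) TX] := opnorm_ex X.
apply: (@opnorm_lim_uniq _ _ _ _ (c * k)) => n; exists (euler 0 n X); split=> //.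
have -> : euler 0 n X = X.
  rewrite /euler; elim: (2 ^ n)%N => //= m ->.
  by rewrite /euler_step mul0r scale0r addr0.
by rewrite subrr; apply: opnorm0; rewrite divr_ge0 ?mulr_ge0// ltW.
Qed.

Lemma euler_limit_fix t X : 0 <= t -> L X = 0 -> T t X = X.
Proof.
move=> /euler_limit_small[c c0 Tc] LX.
have [k k0 /(Tc _ _ k0) TX] := opnorm_ex X.
apply: (@opnorm_lim_uniq _ _ _ _ (c * k)) => n; exists (euler t n X); split=> //.
have -> : euler t n X = X.
  rewrite /euler; elim: (2 ^ n)%N => //= m ->.
  by rewrite /euler_step LX scaler0 addr0.
by rewrite subrr; apply: opnorm0; rewrite divr_ge0 ?mulr_ge0// ltW.
Qed.

Let euler_step_comm s t n X :
  euler_step s n (euler_step t n X) = euler_step t n (euler_step s n X).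
Proof.
apply: (addIr (- euler_step (s + t) n X)).
by rewrite euler_stepD [s + t]addrC euler_stepD mulrC.
Qed.

(** Three errors separate T_s T_t from the Euler map at time s + t: those of the
    two factors, and the O(1/N) cost of merging the steps s/N and t/N. *)
Lemma euler_limitD s t X : 0 <= s -> 0 <= t -> T (s + t) X = T s (T t X).
Proof.
move=> s0 t0; have st0 : 0 <= s + t by rewrite addr_ge0.
have [c c0 Tc] := euler_limit_small st0.
have [cs cs0 Tcs] := euler_limit_small s0.
have [ct ct0 Tct] := euler_limit_small t0.
have [k k0 Xk] := opnorm_ex X; have [k' k'0 TXk'] := opnorm_ex (T t X).
set d := s * t * (l * l); have d0 : 0 <= d by rewrite !mulr_ge0.
pose u := c * k; pose v := cs * k' + expR (s * l) * (ct * k) + expR ((s + t) * l) * d * k.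
have u0 : 0 <= u by rewrite mulr_ge0.
have v0 : 0 <= v by rewrite !addr_ge0// !mulr_ge0 ?expR_ge0.
apply: (@opnorm_lim_uniq _ _ _ _ (u + v)) => n; exists (euler (s + t) n X).
have i0 : 0 <= (2 ^+ n)^-1 :> R by rewrite invr_ge0 ltW.
split.
  by apply: opnorm_le_trans (Tc _ _ k0 Xk n); rewrite ler_wpM2r// lerDl.
apply: (@opnorm_le_trans _ _ _ (v / 2 ^+ n)); first by rewrite ler_wpM2r// lerDr.
rewrite -(subrKA (euler s n (T t X))) -(subrKA (euler s n (euler t n X)) (euler s n _)).
rewrite addrA /v !mulrDl; apply: opnormD; first apply: opnormD.
- exact: Tcs.
- have -> : euler s n (T t X) - euler s n (euler t n X) = euler s n (T t X - euler t n X).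
    by rewrite (bop_mapB _ _ (@euler_linear s n)).
  by rewrite -mulrA; apply: euler_norm => //; exact: Tct.
- have -> : euler s n (euler t n X) =
      iter (2 ^ n) (fun X => euler_step s n (euler_step t n X)) X.
    rewrite /euler; elim: (2 ^ n)%N => //= m IH.
    rewrite -IH; congr euler_step.
    elim: m (iter m (euler_step t n) X) {IH} => //= m IH Y.
    by rewrite IH euler_step_comm.
  rewrite [_ * k / _]mulrAC.
  apply: (@mapnorm_iter_pow2 _ _ _ (euler_step (s + t) n)) Xk => //.
  + by move=> a Y Z; rewrite !euler_step_linear.
  + by rewrite addr_ge0// mulr_ge0.
  + by rewrite mulrDl expRD; apply: mapnorm_comp; exact: euler_step_norm.
  + by rewrite -mulrDl; exact: euler_step_norm.
  + apply: eq_mapnorm; first by move=> Y; rewrite euler_stepD -rmorphM /=.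
    apply: mapnorm_trans (LL_le _).
    rewrite ger0_norm; last by rewrite mulr_ge0 ?divr_ge0// ltW.
    rewrite le_eqVlt; apply/orP; left; apply/eqP; rewrite /d; field.
    by rewrite gt_eqF.
Qed.

(** The error bound at n = 0, where the Euler map is 1 + tL. *)
Lemma euler_limit_derive t : 0 <= t ->
  mapnorm_le (fun X => T t X - X - (t%:C)%C *: L X) (expR (t * l) * ((t * l) ^+ 2 / 2)).
Proof.
move=> t0; have := T_lim 0 t0; rewrite expr0 divr1.
by apply: eq_mapnorm => X; rewrite /euler/= /euler_step expr0 divr1 opprD addrA.
Qed.

End EulerLimit.

End EulerScheme.

(** * Adjoints and positive operators *)

Section Adjoints.
Context (R : realType) (G : hilbertType R).
Implicit Types (A B V X Y Z : bop G) (x y z : G).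

Lemma is_adjointD A A' B B' : is_adjoint A A' -> is_adjoint B B' ->
  is_adjoint (A + B) (A' + B').
Proof. by move=> AA BB x y; rewrite !bopE !ipE AA BB. Qed.

Lemma is_adjointZ a A A' : is_adjoint A A' -> is_adjoint (a *: A) (a^* *: A').
Proof. by move=> AA x y; rewrite !bopE !ipE AA conjCK. Qed.

Lemma is_adjoint1 : is_adjoint (1 : bop G) 1. Proof. by []. Qed.

Lemma is_adjoint_sym A B : is_adjoint A B -> is_adjoint B A.
Proof. by move=> AB x y; rewrite ipC -AB -ipC. Qed.

Lemma rank1E x y : rank1 x y = ip y x *: x. Proof. by []. Qed.

Lemma rank1_selfadjoint x : selfadjoint (rank1 x).
Proof. by move=> y z; rewrite !rank1E !ipE [in RHS]mulrC -ipC. Qed.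

Definition qform Z x : R := complex.Re (ip (Z x) x).

Lemma qformD A B x : qform (A + B) x = qform A x + qform B x.
Proof. by rewrite /qform bopE ipE ReD. Qed.

Lemma qformB A B x : qform (A - B) x = qform A x - qform B x.
Proof. by rewrite qformD; congr (_ + _); rewrite /qform bopE ipE ReN. Qed.

Lemma qformE Z x : positive_op Z -> ip (Z x) x = ((qform Z x)%:C)%C.
Proof. by move=> /(_ x) Zx; rewrite /qform RRe_real// ger0_real. Qed.

Lemma qform_ge0 Z x : positive_op Z -> 0 <= qform Z x.
Proof. by move=> Zp; rewrite -lecR -qformE. Qed.

Lemma qform_le A B x : op_le A B -> qform A x <= qform B x.
Proof. by move=> /(@qform_ge0 _ x); rewrite qformB subr_ge0. Qed.

Lemma qform_bound Z x k : opnorm_le Z k -> qform Z x <= k * rnorm x ^+ 2.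
Proof.
move=> /opnormP/(_ x) Zx; apply: le_trans (ler_norm _) _.
apply: le_trans (rnorm_Re _) _; apply: le_trans (rnorm_ip _ _) _.
by rewrite expr2 mulrA ler_wpM2r// rnorm_ge0.
Qed.

Lemma op_le_trans A B Z : op_le A B -> op_le B Z -> op_le A Z.
Proof.
by move=> AB BZ x; rewrite -(subrKA B) addrC bopD ipE addr_ge0.
Qed.

(** Polarization: the form is real on x + y and on x + iy. *)
Lemma positive_selfadjoint Z : positive_op Z -> selfadjoint Z.
Proof.
move=> Zp x y.
have real z : (ip (Z z) z)^* = ip (Z z) z by rewrite (qformE _ Zp) conj_RC.
have E1 : (ip (Z x) y)^* + (ip (Z y) x)^* = ip (Z x) y + ip (Z y) x.
  have := real (x + y); rewrite !(bopE, ipE) !rmorphD /= !real => /eqP.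
  rewrite -!addrA (inj_eq (addrI _)) !addrA (inj_eq (addIr _)) => /eqP.
  by rewrite addrC [RHS]addrC.
have E2 : (ip (Z x) y)^* - (ip (Z y) x)^* = - ip (Z x) y + ip (Z y) x.
  have i0 := i_neq0 R.
  have := real (x + 'i%C *: y).
  rewrite !(bopE, ipE) !rmorphD /= !rmorphM /= !real conj_i !rmorphN /= conj_i opprK.
  set a' := (ip (Z x) y)^*; set b' := (ip (Z y) x)^*; set i := 'i%C in i0 *.
  move=> E; apply: (mulfI i0).
  have -> : i * (a' - b') = (ip (Z x) x + - i * b' + (i * a' + - i * (i * ip (Z y) y)))
    - ip (Z x) x + i * (i * ip (Z y) y) by ring.
  by rewrite E; ring.
rewrite [RHS]ipC.
have -> : (ip (Z y) x)^* = (((ip (Z x) y)^* + (ip (Z y) x)^*) -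
   ((ip (Z x) y)^* - (ip (Z y) x)^*)) / 2 by field.
by rewrite E1 E2; field.
Qed.

Lemma sqr_rnorm (c : R[i]) : c * c^* = ((rnorm c ^+ 2)%:C)%C.
Proof. by rewrite rmorphXn /= rnormE normCK. Qed.

Lemma positive_cauchy_schwarz Z x z : positive_op Z ->
  rnorm (ip (Z x) z) ^+ 2 <= qform Z x * qform Z z.
Proof.
move=> Zp; pose c := ip (Z x) z; rewrite -/c; set n := rnorm c ^+ 2.
have Zs : 0 <= n by rewrite sqr_ge0.
have nE : (n%:C)%C = c * c^* by rewrite sqr_rnorm.
clearbody n.
(* Positivity at x - s c z, for every real s. *)
have H s : 0 <= qform Z x - 2 * s * n + s * s * n * qform Z z.
  rewrite -lecR.
  have -> : ((qform Z x - 2 * s * n + s * s * n * qform Z z)%:C)%C =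
      ip (Z (x - (s%:C%C * c) *: z)) (x - (s%:C%C * c) *: z); last exact: Zp.
  rewrite !(bopE, ipE) !rmorphM /= conj_RC.
  have -> : ip (Z z) x = c^* by rewrite (positive_selfadjoint Zp) -ipC.
  rewrite -/c (qformE x Zp) (qformE z Zp) !rmorphD /= !rmorphN /= !rmorphM /= nE.
  by rewrite rmorph_nat; ring.
have q0 := qform_ge0 z Zp.
have [qz|qz] := eqVneq (qform Z z) 0.
  rewrite qz mulr0 leNgt; apply/negP => n0.
  have := H ((qform Z x + 1) / (2 * n)); rewrite qz mulr0 addr0.
  have -> : 2 * ((qform Z x + 1) / (2 * n)) * n = qform Z x + 1.
    by field; rewrite gt_eqF.
  lra.
have {}q0 : 0 < qform Z z by rewrite lt_def qz.
have := H (qform Z z)^-1.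
have -> : (qform Z z)^-1 * (qform Z z)^-1 * n * qform Z z = n / qform Z z by field.
rewrite -[2 * _ * n]mulrA [_^-1 * n]mulrC => H'.
by rewrite -ler_pdivrMr//; lra.
Qed.

(** Cauchy-Schwarz for the form of Z at x and Z x: a positive operator is small
    at x as soon as its quadratic form is. *)
Lemma positive_rnorm Z k x : positive_op Z -> 0 <= k ->
  (forall z, qform Z z <= k * rnorm z ^+ 2) -> rnorm (Z x) ^+ 2 <= k * qform Z x.
Proof.
move=> Zp k0 Zk.
have := positive_cauchy_schwarz x (Z x) Zp; rewrite ip_rnorm rnorm_real.
set n := rnorm (Z x) ^+ 2; have n0 : 0 <= n by rewrite sqr_ge0.
rewrite real_normK ?num_real// => nn; have q0 := qform_ge0 x Zp.
have [->|n1] := eqVneq n 0; first exact: mulr_ge0.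
have : n * n <= k * qform Z x * n.
  rewrite -expr2 (le_trans nn)// mulrAC [leLHS]mulrC ler_wpM2r//; exact: Zk.
by rewrite ler_pM2r// lt_def n1.
Qed.

End Adjoints.

(** * Normality and complete positivity *)

Section NormalMaps.
Context (R : realType) (G : hilbertType R).
Implicit Types (A B V X Y Z : bop G) (x y z : G) (D : set (bop G)).
Implicit Types (Phi Psi : bop G -> bop G).

Lemma le_pow2_small (a b c : R) : (forall n, a <= b + c / 2 ^+ n) -> a <= b.
Proof.
move=> abc; rewrite leNgt; apply/negP => ab.
have [|n cn] := @pow2_small _ c (a - b); first by rewrite subr_gt0.
by have := abc n; rewrite leNgt => /negP; apply; lra.
Qed.

(** The supremum of a directed family is its weak limit.  Otherwise the forms of
    Z = X - A at some x stay above e for all A in D.  They decrease along D, so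
    by [positive_rnorm] the vectors Z x converge to some y, with <x, y> at least
    e.  Cauchy-Schwarz for Z survives in the limit as yy* <= c Z for all A, hence
    X - yy*/c is a smaller upper bound of D, which is absurd. *)
Lemma op_lub_form D X x (e : R) : op_directed D -> op_lub D X -> 0 < e ->
  exists2 A, D A & qform (X - A) x < e.
Proof.
move=> [[A0 DA0] Ddir] [Xub Xlub] e0; apply: contrapT => /forall2NP noA.
have {}noA A : D A -> e <= qform (X - A) x.
  by move=> DA; have [//|/negP] := noA A; rewrite -leNgt.
pose S := [set qform (X - A) x | A in D].
have S0 : has_inf S.
  split; first by exists (qform (X - A0) x), A0.
  by exists e => _ [A DA <-]; exact: noA.
pose m := inf S.
have mS A : D A -> m <= qform (X - A) x.
  by move=> DA; apply: ge_inf; [exact: S0.2|exists A].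
have [k k0 XAk] := opnorm_ex (X - A0).
(* A n has its form within 4^-n of the infimum, which puts (X - E) x within
   sqrt k / 2^n of (X - A n) x for every E above A n. *)
have e2 n : 0 < (2 ^+ n)^-1 ^+ 2 :> R by rewrite exprn_gt0// invr_gt0 exprn_gt0.
have /choice[A AP] : forall n, exists A,
    [/\ D A, op_le A0 A & qform (X - A) x <= m + (2 ^+ n)^-1 ^+ 2].
  move=> n; have [_ [B DB <-] mB] := inf_adherent (e2 n) S0.
  have [E [DE A0E BE]] := Ddir _ _ DA0 DB; exists E; split => //.
  apply: le_trans (ltW mB); rewrite -/m !qformB lerD2l lerN2; exact: qform_le.
have gap n E : D E -> op_le (A n) E ->
    rnorm ((E - A n) x) <= Num.sqrt k / 2 ^+ n.
  move=> DE AE; have [DA A0A mA] := AP n.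
  rewrite -(@ler_pXn2r _ 2) ?nnegrE ?rnorm_ge0 ?divr_ge0 ?sqrtr_ge0 ?exprn_ge0//.
  rewrite exprMn sqr_sqrtr//.
  apply: le_trans (positive_rnorm _ AE k0 _) _.
    move=> z; apply: le_trans (qform_bound z XAk); rewrite !qformB.
    have := qform_le z A0A; have := qform_le z (Xub _ DE); lra.
  rewrite ler_wpM2l//; have := mS _ DE; move: mA; rewrite !qformB; lra.
have [n|y yP] := @geometric_cauchy _ _ (fun n => (X - A n) x) (2 * Num.sqrt k).
  have [DA A0A _] := AP n; have [DA' A0A' _] := AP n.+1.
  have [E [DE AE AE']] := Ddir _ _ DA DA'.
  have -> : (X - A n.+1) x - (X - A n) x = (E - A n.+1) x - (E - A n) x.
    by rewrite !bopE !opprB ![_ + (A n x - _)]addrC !subrKA.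
  apply: le_trans (rnormB _ _) _.
  have := gap _ _ DE AE; have := gap _ _ DE AE'.
  rewrite exprS invfM.
  have : 0 <= Num.sqrt k / 2 ^+ n by rewrite divr_ge0 ?sqrtr_ge0 ?exprn_ge0.
  lra.
pose c := qform (X - A0) x.
have c0 : 0 < c by exact: lt_le_trans (noA _ DA0).
(* The bound is transferred from E, above both A n and B, where (X - E) x is
   close to y and the form of X - E is below those of X - A0 and X - B. *)
have yle B z : D B -> rnorm (ip y z) ^+ 2 <= c * qform (X - B) z.
  move=> DB; have qB : 0 <= qform (X - B) z by apply/qform_ge0/Xub.
  have cq : 0 <= c * qform (X - B) z by rewrite mulr_ge0// ltW.
  rewrite -[leRHS]sqr_sqrtr// ler_pXn2r ?nnegrE ?rnorm_ge0 ?sqrtr_ge0//.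
  apply: (@le_pow2_small _ _ ((5 * Num.sqrt k) * rnorm z)) => n.
  have [DA A0A _] := AP n; have [E [DE AE BE]] := Ddir _ _ DA DB.
  have -> : y = (y - (X - A n) x) + (E - A n) x + (X - E) x.
    by rewrite -addrA -bopD [E - _ + _]addrC subrKA subrK.
  rewrite ipDl [X in rnorm (X + _)]ipDl; apply: le_trans (rnormD _ _) _.
  rewrite addrC; apply: lerD.
    rewrite -(@ler_pXn2r _ 2) ?nnegrE ?rnorm_ge0 ?sqrtr_ge0// sqr_sqrtr//.
    apply: le_trans (positive_cauchy_schwarz _ _ (Xub _ DE)) _.
    apply: ler_pM; rewrite ?qform_ge0//; try exact: Xub.
      rewrite /c !qformB lerD2l lerN2; apply: qform_le; exact: op_le_trans AE.
    by rewrite !qformB lerD2l lerN2; exact: qform_le.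
  apply: le_trans (rnormD _ _) _; rewrite [5 * _]mulrDl.
  apply: (@le_trans _ _ (2 * (2 * Num.sqrt k) / 2 ^+ n * rnorm z +
    Num.sqrt k / 2 ^+ n * rnorm z)).
    apply: lerD; apply: le_trans (rnorm_ip _ _) _; rewrite ler_wpM2r ?rnorm_ge0//.
    exact: gap.
  by rewrite le_eqVlt; apply/orP; left; apply/eqP; field; rewrite gt_eqF// exprn_gt0.
have y0 : y = 0.
  have : op_le X (X - ((c^-1)%:C)%C *: rank1 y).
    apply: Xlub => B DB z.
    have -> : X - ((c^-1)%:C)%C *: rank1 y - B =
      (X - B) - ((c^-1)%:C)%C *: rank1 y by rewrite addrAC.
    rewrite bopB ipDl ipNl (qformE z (Xub _ DB)) bopZ rank1E !ipZl.
    rewrite [ip z y]ipC [_^* * _]mulrC sqr_rnorm -rmorphM -rmorphB /=.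
    rewrite -[0]/((0 : R)%:C)%C lecR subr_ge0 ler_pdivrMl//; exact: yle.
  move=> /(_ y); rewrite addrAC subrr add0r bopN ipNl bopZ rank1E !ipZl ip_rnorm.
  rewrite -!rmorphM -rmorphN /= -[0]/((0 : R)%:C)%C lecR.
  rewrite oppr_ge0 pmulr_rle0 ?invr_gt0// -expr2 => yy.
  apply/rnorm0_eq0/eqP; rewrite -sqrf_eq0 -sqrf_eq0 eq_le yy/=.
  exact: sqr_ge0.
suff : e <= 0 by rewrite leNgt e0.
apply: (@le_pow2_small _ _ (2 * (2 * Num.sqrt k) * rnorm x)) => n.
have [DA _ _] := AP n; have := yP n; rewrite y0 sub0r rnormN => yx.
rewrite add0r; apply: le_trans (noA _ DA) _; apply: le_trans (ler_norm _) _.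
apply: le_trans (rnorm_Re _) _; apply: le_trans (rnorm_ip _ _) _.
by rewrite mulrAC ler_wpM2r// rnorm_ge0.
Qed.


(** Directed downwards in place of upwards: X - A for A in a directed family with
    supremum X. *)
Definition decreasing_to0 D :=
  [/\ D `<=` (@positive_op R G),
      forall A B, D A -> D B -> exists E, [/\ D E, op_le E A & op_le E B]
    & forall x (e : R), 0 < e -> exists2 Z, D Z & qform Z x < e].

(** Normality of positive maps in a form that is stable under sums and products
    and is immediate for conjugations: weak convergence to 0 along a decreasing
    family is preserved. *)
Definition cp_normal Phi :=
  [/\ linear Phi, completely_positive Phi
    & forall D, decreasing_to0 D -> forall x (e : R), 0 < e ->
        exists2 Z, D Z & qform (Phi Z) x < e].

(** The case of one by one matrices. *)
Lemma cp_positive Phi Z : completely_positive Phi ->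
  positive_op Z -> positive_op (Phi Z).
Proof.
move=> cpP Zp x.
have P1 (Y : bop G) (v : 'I_1 -> G) :
    \sum_i \sum_j ip ((const_mx Y : 'M_1) i j (v j)) (v i) = ip (Y (v 0)) (v 0).
  by rewrite !big_ord1 mxE.
have Zm : positive_opmx (const_mx Z : 'M_1) by move=> v; rewrite P1; exact: Zp.
by have := cpP _ _ Zm (fun=> x); rewrite map_const_mx P1.
Qed.

Lemma cp_le Phi A B : linear Phi -> completely_positive Phi ->
  op_le A B -> op_le (Phi A) (Phi B).
Proof.
by move=> lP cpP AB; rewrite /op_le -(bop_mapB _ _ lP); exact: cp_positive.
Qed.

Lemma decreasing_to0_image Phi D :
  cp_normal Phi -> decreasing_to0 D -> decreasing_to0 (Phi @` D).
Proof.
move=> [lP cpP nP] D0; have [Dp Ddir Df] := D0; split.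
- by move=> _ [Z DZ <-]; apply: cp_positive => //; exact: Dp.
- move=> _ _ [A DA <-] [B DB <-]; have [E [DE EA EB]] := Ddir _ _ DA DB.
  by exists (Phi E); split; [exists E|exact: cp_le|exact: cp_le].
- by move=> x e e0; have [Z DZ Ze] := nP _ D0 x e e0; exists (Phi Z) => //; exists Z.
Qed.

Lemma cp_normal_id : cp_normal id.
Proof.
split=> [//|n X Xp|D [_ _ //]].
by rewrite (_ : map_mx id X = X)//; apply/matrixP => i j; rewrite mxE.
Qed.

Lemma cp_normal_comp Phi Psi : cp_normal Phi -> cp_normal Psi ->
  cp_normal (fun X => Phi (Psi X)).
Proof.
move=> nP nQ; have [lP cP fP] := nP; have [lQ cQ fQ] := nQ; split.
- by move=> a X Y; rewrite lQ lP.
- move=> n X Xp; rewrite (_ : map_mx _ X = map_mx Phi (map_mx Psi X)).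
    exact/cP/cQ.
  by apply/matrixP => i j; rewrite !mxE.
- move=> D D0 x e e0.
  by have [_ [Z DZ <-] Ze] := fP _ (decreasing_to0_image nQ D0) x e e0; exists Z.
Qed.

Lemma cp_normal_iter Phi n : cp_normal Phi -> cp_normal (iter n Phi).
Proof.
by move=> nP; elim: n => [|n IH]; [exact: cp_normal_id|exact: cp_normal_comp].
Qed.

Lemma cp_normal_add Phi Psi : cp_normal Phi -> cp_normal Psi ->
  cp_normal (fun X => Phi X + Psi X).
Proof.
move=> [lP cP fP] [lQ cQ fQ]; split.
- by move=> a X Y; rewrite lP lQ scalerDr addrACA.
- move=> n X Xp v.
  rewrite (eq_bigr (fun i => \sum_j ip (map_mx Phi X i j (v j)) (v i) +
      \sum_j ip (map_mx Psi X i j (v j)) (v i))) => [|i _].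
    by rewrite big_split addr_ge0//; [exact: cP|exact: cQ].
  by rewrite -big_split; apply: eq_bigr => j _; rewrite !mxE bopE ipDl.
- move=> D D0 x e e0; have e20 : 0 < e / 2 by rewrite divr_gt0.
  have [Dp Ddir _] := D0.
  have [A DA Ae] := fP _ D0 x _ e20; have [B DB Be] := fQ _ D0 x _ e20.
  have [E [DE EA EB]] := Ddir _ _ DA DB; exists E => //; rewrite qformD.
  have := qform_le x (cp_le lP cP EA); have := qform_le x (cp_le lQ cQ EB); lra.
Qed.

Lemma cp_normal_conj V V' : is_adjoint V V' -> cp_normal (fun X => V * X * V').
Proof.
move=> VV'.
have E X x y : ip ((V * X * V') x) y = ip (X (V' x)) (V' y) by rewrite !bopE VV'.
split.
- by move=> a X Y; rewrite mulrDr mulrDl bopZAr bopZAl.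
- move=> n X Xp v; have := Xp (fun i => V' (v i)).
  by under eq_bigr do under eq_bigr do rewrite -E; under [X in _ -> 0 <= X]eq_bigr do
    under eq_bigr do rewrite mxE.
- move=> D [_ _ f0] x e e0; have [Z DZ Ze] := f0 (V' x) e e0.
  by exists Z => //; rewrite /qform E.
Qed.

(** Norm limits preserve complete positivity entrywise.  For normality the family
    X - A is first cut to A above one fixed A0, which bounds its norms uniformly,
    so that the error of the approximation Psi is uniform along the family. *)
Lemma cp_normal_markov Phi c : linear Phi -> Phi 1 = 1 ->
  (forall n, exists2 Psi, cp_normal Psi &
    mapnorm_le (fun X => Phi X - Psi X) (c / 2 ^+ n)) ->
  markov_map Phi.
Proof.
move=> lP P1 Plim.
have cP : completely_positive Phi.
  move=> n X Xp v.
  have /choice[k kP] : forall p : 'I_n * 'I_n, exists k, opnorm_le (X p.1 p.2) k.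
    by move=> p; have [k _ Xk] := opnorm_ex (X p.1 p.2); exists k.
  apply: (@complex_lim_ge0 _ _
    (\sum_i \sum_j c * k (i, j) * rnorm (v j) * rnorm (v i))) => m.
  have [Psi [lQ cQ _] PQ] := Plim m.
  exists (\sum_i \sum_j ip (map_mx Psi X i j (v j)) (v i)); first exact: cQ.
  rewrite -sumrB mulr_suml; apply: le_trans (rnorm_sum _ _ _) _.
  apply: ler_sum => i _; rewrite -sumrB mulr_suml; apply: le_trans (rnorm_sum _ _ _) _.
  apply: ler_sum => j _; rewrite !mxE -ipNl -ipDl; apply: le_trans (rnorm_ip _ _) _.
  rewrite mulrAC ler_wpM2r ?rnorm_ge0//.
  have /opnormP := PQ _ _ (kP (i, j)) => /(_ (v j)) /le_trans; apply.
  by rewrite [c / _ * _]mulrAC [leLHS]mulrAC.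
split=> // D X Dsa Ddir Dlub; have [Xub Xlub] := Dlub; split.
  by move=> _ [A DA <-]; apply: cp_le => //; exact: Xub.
move=> B Bub x.
have [[A0 DA0] Ddir2] := Ddir.
have [k k0 XAk] := opnorm_ex (X - A0).
pose D0 := [set X - A | A in D `&` [set A | op_le A0 A]].
have D0d : decreasing_to0 D0.
  split.
  - by move=> _ [A [DA _] <-]; exact: Xub.
  - move=> _ _ [A [DA A0A] <-] [A' [DA' A0A'] <-].
    have [E [DE AE AE']] := Ddir2 _ _ DA DA'; exists (X - E); split.
    + by exists E => //; split => //; exact: op_le_trans AE.
    + by rewrite /op_le opprB addrC subrKA.
    + by rewrite /op_le opprB addrC subrKA.
  - move=> y e e0; have [A DA Ae] := op_lub_form y Ddir Dlub e0.
    have [E [DE AE AE']] := Ddir2 _ _ DA DA0; exists (X - E); first by exists E.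
    apply: le_lt_trans Ae; rewrite !qformB lerD2l lerN2; exact: qform_le.
have D0k Z : D0 Z -> forall y, rnorm (Z y) <= k * rnorm y.
  move=> [A [DA A0A] <-] y.
  rewrite -(@ler_pXn2r _ 2) ?nnegrE ?mulr_ge0 ?rnorm_ge0//.
  have qk z : qform (X - A) z <= k * rnorm z ^+ 2.
    apply: le_trans (qform_bound z XAk); rewrite !qformB lerD2l lerN2.
    exact: qform_le.
  apply: le_trans (positive_rnorm y (Xub _ DA) k0 qk) _.
  by rewrite exprMn expr2 -mulrA ler_wpM2l.
apply: (@complex_lim_ge0 _ _ (c * k * rnorm x ^+ 2 + 1)) => n.
have [Psi [lQ cQ fQ] PQ] := Plim n.
have n0 : 0 < (2 ^+ n)^-1 :> R by rewrite invr_gt0 exprn_gt0.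
have [_ [A [DA A0A] <-] Ae] := fQ _ D0d x _ n0.
exists (ip ((B - Phi A) x) x); first by apply: Bub; exists A.
rewrite -ipNl -ipDl -bopN -bopD.
have -> : B - Phi X - (B - Phi A) = - (Phi (X - A)).
  by rewrite (bop_mapB _ _ lP) !opprB addrC addrA subrK.
rewrite bopN ipNl rnormN.
have -> : Phi (X - A) = (Phi (X - A) - Psi (X - A)) + Psi (X - A) by rewrite subrK.
rewrite bopD ipDl; apply: le_trans (rnormD _ _) _; rewrite mulrDl; apply: lerD.
  have XAk' : opnorm_le (X - A) k.
    by apply/opnormP => y; apply: D0k; exists A.
  apply: le_trans (rnorm_ip _ _) _; rewrite expr2 mulrA.
  rewrite mulrAC ler_wpM2r ?rnorm_ge0// mulrAC.
  by have /opnormP/(_ x) := PQ _ _ XAk'; rewrite [c / _ * _]mulrAC.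
have Pp : positive_op (Psi (X - A)) by apply: cp_positive => //; exact: Xub.
rewrite (qformE _ Pp) rnorm_real ger0_norm ?qform_ge0// mul1r.
exact: ltW.
Qed.

End NormalMaps.

(** * The Markov semigroup generated by L *)

Section Generator.
Context (R : realType) (G : hilbertType R).
Implicit Types (A B X Y H : bop G) (e x : G).

Lemma rank1_idem e : `|e| = 1 -> rank1 e * rank1 e = rank1 e.
Proof.
by move=> e1; apply/bopP => x; rewrite bopE !rank1E ipZl ip_norm e1 expr1n mulr1.
Qed.

(** L(X) = PXP + KX + XK*, with K = iH - P/2 and [Kgen'] its adjoint. *)
Definition Kgen e H : bop G := 'i%C *: H - 2^-1 *: rank1 e.
Definition Kgen' e H : bop G := - ('i%C *: H) - 2^-1 *: rank1 e.

Lemma Kgen_adjoint e H : selfadjoint H -> is_adjoint (Kgen e H) (Kgen' e H).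
Proof.
move=> Hsa; rewrite /Kgen /Kgen'.
have -> : - ('i%C *: H) - 2^-1 *: rank1 e =
    ('i%C)^* *: H + (- 2^-1)^* *: rank1 e :> bop G.
  by rewrite conj_i scaleNr rmorphN /= fmorphV rmorph_nat scaleNr.
by rewrite -scaleNr; apply: is_adjointD; apply: is_adjointZ => //; exact: rank1_selfadjoint.
Qed.

Lemma LgenE e H X :
  Lgen e H X = rank1 e * X * rank1 e + (Kgen e H * X + X * Kgen' e H).
Proof.
rewrite /Lgen /op_bracket /Kgen /Kgen' -[LHS]addrA; congr (_ + _).
rewrite [in RHS]mulrDl [in RHS]mulrDr !bopNAl !bopNAr !bopZAl !bopZAr addrACA addrC.
by rewrite -opprD -scalerDr scalerBr.
Qed.

Lemma Lgen_linear e H : linear (Lgen e H).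
Proof.
move=> a X Y; rewrite !LgenE; move: (Kgen e H) (Kgen' e H) (rank1 e) => K K' P.
rewrite !mulrDr !mulrDl !bopZAr !bopZAl !scalerDr.
by rewrite [X in _ + X = _]addrACA [LHS]addrACA.
Qed.

Lemma Lgen1 e H : `|e| = 1 -> Lgen e H 1 = 0.
Proof.
move=> e1; rewrite /Lgen /op_bracket !mulr1 !mul1r subrr scaler0 addr0 rank1_idem//.
have -> : rank1 e + rank1 e = 2 *: rank1 e :> bop G by rewrite scaler_nat mulr2n.
by rewrite scalerA mulVf ?pnatr_eq0// scale1r subrr.
Qed.

Lemma Lgen_bounded e H : exists2 l, 0 <= l & mapnorm_le (Lgen e H) l.
Proof.
have [p p0 Pp] := opnorm_ex (rank1 e); have [k k0 Kk] := opnorm_ex (Kgen e H).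
have [k' k'0 Kk'] := opnorm_ex (Kgen' e H).
exists (p * p + (k + k')); first by rewrite !addr_ge0// mulr_ge0.
apply: mapnormP => X c c0 Xc; rewrite LgenE [_ * c]mulrDl [(k + k') * c]mulrDl; apply: opnormD.
  by rewrite mulrAC; apply: opnormM => //; [exact: mulr_ge0|exact: opnormM].
by apply: opnormD; [exact: opnormM|rewrite mulrC; exact: opnormM].
Qed.

(** A completely positive map that agrees with 1 + tL to first order; the square
    root splits t PXP as a conjugation. *)
Definition kraus_step e H (t : R) X : bop G :=
  (1 + (t%:C)%C *: Kgen e H) * X * (1 + (t%:C)%C *: Kgen' e H) +
  ((Num.sqrt t)%:C)%C *: rank1 e * X * (((Num.sqrt t)%:C)%C *: rank1 e).

Lemma kraus_stepE e H (t : R) X : 0 <= t ->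
  kraus_step e H t X = X + (t%:C)%C *: Lgen e H X +
    ((t * t)%:C)%C *: (Kgen e H * X * Kgen' e H).
Proof.
move=> t0; rewrite /kraus_step LgenE; move: (Kgen e H) (Kgen' e H) (rank1 e) => K K' P.
have -> (a : R[i]) : a *: P * X * (a *: P) = (a * a) *: (P * X * P).
  by rewrite bopZAr !bopZAl scalerA.
rewrite -rmorphM /= -expr2 sqr_sqrtr//; set a := (t%:C)%C.
have -> : (1 + a *: K) * X * (1 + a *: K') =
    X + (a *: (K * X + X * K') + (a * a) *: (K * X * K')).
  rewrite mulrDr mulr1 !mulrDl !mul1r !bopZAr !bopZAl scalerDr scalerA.
  by rewrite -!addrA; congr (_ + _); rewrite !addrA; congr (_ + _).
rewrite rmorphM /= [_ *: (P * X * P + _)]scalerDr -!addrA; congr (_ + _).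
by rewrite addrA addrC.
Qed.

Lemma kraus_step_cp_normal e H (t : R) : selfadjoint H -> 0 <= t ->
  cp_normal (kraus_step e H t).
Proof.
move=> Hsa t0; apply: cp_normal_add; apply: cp_normal_conj.
  apply: is_adjointD; first exact: is_adjoint1.
  by rewrite -[X in is_adjoint _ (X *: _)]conj_RC; apply/is_adjointZ/Kgen_adjoint.
by rewrite -[X in is_adjoint _ (X *: _)]conj_RC; apply/is_adjointZ/rank1_selfadjoint.
Qed.

Lemma Lgen_semigroup e H : `|e| = 1 -> selfadjoint H ->
  exists T : R -> bop G -> bop G,
    [/\ markov_semigroup T, uniformly_continuous T & generator_of T (Lgen e H)].
Proof.
move=> e1 Hsa; have [l l0 Ll] := Lgen_bounded e H; have lL := Lgen_linear e H.
have [T T_lim] := euler_limit_ex lL Ll l0; exists T.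
have [k k0 Kk] := opnorm_ex (Kgen e H); have [k' k'0 Kk'] := opnorm_ex (Kgen' e H).
have KXK : mapnorm_le (fun X => Kgen e H * X * Kgen' e H) (k * k').
  apply: mapnormP => X c c0 Xc.
  by rewrite mulrAC; apply: opnormM => //; [exact: mulr_ge0|exact: opnormM].
have kk0 : 0 <= k * k' by rewrite mulr_ge0.
have T_markov t : 0 <= t -> markov_map (T t).
  move=> t0; pose m := t ^+ 2 * (k * k'); pose s := t * l + m.
  have m0 : 0 <= m by rewrite mulr_ge0 ?sqr_ge0.
  have s0 : 0 <= s by rewrite addr_ge0// mulr_ge0.
  pose c := expR (t * l) * ((t * l) ^+ 2 / 2) + expR s * m.
  apply: (@cp_normal_markov _ _ _ c).
  - exact: (euler_limit_linear lL T_lim t0).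
  - by apply: (euler_limit_fix T_lim) => //; exact: Lgen1.
  (* Approximate by powers of the completely positive step h = t / 2^n; its norm
     is at most 1 + hl + h^2 kk', hence at most exp(s / 2^n). *)
  move=> n; pose h := t / 2 ^+ n.
  have p0 : 0 < 2 ^+ n :> R by rewrite exprn_gt0.
  have p1 : 1 <= 2 ^+ n :> R by rewrite exprn_ege1// ler1n.
  have h0 : 0 <= h by rewrite divr_ge0// ltW.
  exists (iter (2 ^ n) (kraus_step e H h)).
    by apply/cp_normal_iter/kraus_step_cp_normal.
  apply: (@eq_mapnorm _ _ (fun X => (T t X - euler (Lgen e H) t n X) +
      (euler (Lgen e H) t n X - iter (2 ^ n) (kraus_step e H h) X))).
    by move=> X; rewrite subrKA.
  rewrite mulrDl; apply: mapnormD; first exact: T_lim.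
  have mE : m / (2 ^+ n * 2 ^+ n) = h ^+ 2 * (k * k').
    by rewrite /m /h; field; rewrite gt_eqF.
  have mp : m / (2 ^+ n * 2 ^+ n) <= m / 2 ^+ n.
    by rewrite ler_wpM2l// lef_pV2 ?posrE ?mulr_gt0// ler_peMr// ltW.
  have KK : mapnorm_le (fun X => ((h ^+ 2)%:C)%C *: (Kgen e H * X * Kgen' e H))
      (m / (2 ^+ n * 2 ^+ n)).
    rewrite mE -[X in X * (k * k')]ger0_norm ?sqr_ge0// -rnorm_real.
    exact: mapnormZ.
  apply: (@mapnorm_iter_pow2 _ _ _ _ s) => //.
  - exact: euler_step_linear.
  - apply: mapnorm_trans (euler_step_norm Ll n t0).
    by rewrite ler_expR ler_wpM2r ?lerDl// invr_ge0 ltW.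
  - apply: (@eq_mapnorm _ _ (fun X => (X + (h%:C)%C *: Lgen e H X) +
      ((h ^+ 2)%:C)%C *: (Kgen e H * X * Kgen' e H))).
      by move=> X; rewrite kraus_stepE.
    apply: (@mapnorm_trans _ _ _ (1 + rnorm (h%:C)%C * l + m / (2 ^+ n * 2 ^+ n))).
      apply: le_trans (expR_ge1Dx _); rewrite -addrA lerD2l [s / _]mulrDl lerD//.
      by rewrite rnorm_real ger0_norm// mulrAC.
    by apply: mapnormD => //; apply: mapnormD; [exact: mapnorm_id|exact: mapnormZ].
  - apply: (@eq_mapnorm _ _ (fun X => (-1) *: (((h ^+ 2)%:C)%C *: (Kgen e H * X * Kgen' e H)))).
      by move=> X; rewrite kraus_stepE// scaleN1r opprD addrA subrr add0r.
    rewrite -[X in mapnorm_le _ X]mul1r -[X in X * _](@rnorm1 R) -[X in X * _]rnormN.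
    exact: mapnormZ.
pose M := expR l * l ^+ 2.
have M0 : 0 <= M by rewrite mulr_ge0 ?expR_ge0 ?sqr_ge0.
have T_diff t : 0 < t -> t < 1 ->
    mapnorm_le (fun X => T t X - X - (t%:C)%C *: Lgen e H X) (t * (t * M)).
  move=> t0 t1; apply: mapnorm_trans (euler_limit_derive T_lim (ltW t0)).
  have -> : t * (t * M) = expR l * (t * l) ^+ 2 by rewrite /M; ring.
  apply: ler_pM; rewrite ?expR_ge0 ?divr_ge0 ?sqr_ge0//.
    by rewrite ler_expR ler_piMl// ltW.
  by rewrite ler_pdivrMr// ler_peMr ?sqr_ge0// ler1n.
split.
- split=> [//|X|s t s0 t0 X]; first exact: (euler_limit0 T_lim).
  exact: (euler_limitD lL Ll l0 T_lim).
- move=> eps eps0.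
  have lM : 0 < l + M + 1 by rewrite ltr_wpDl// addr_ge0.
  near=> t.
  have t0 : 0 < t by near: t; exact: nbhs_right_gt.
  have t1 : t < 1 by near: t; exact: nbhs_right_lt.
  apply: (@eq_mapnorm _ _ (fun X => (T t X - X - (t%:C)%C *: Lgen e H X) +
    (t%:C)%C *: Lgen e H X)); first by move=> X; rewrite subrK.
  apply: (@mapnorm_trans _ _ _ (t * (t * M) + rnorm (t%:C)%C * l)); last first.
    by apply: mapnormD; [exact: T_diff|exact: mapnormZ].
  have : t * (l + M + 1) <= eps.
    rewrite -ler_pdivlMr//; near: t; apply: nbhs_right_le; exact: divr_gt0.
  apply: le_trans; rewrite rnorm_real gtr0_norm// -mulrDr ler_wpM2l ?ltW//.
  have : t * M <= M by rewrite ler_piMl// ltW.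
  lra.
- move=> eps eps0.
  have lM : 0 < M + 1 by rewrite ltr_wpDl.
  near=> t.
  have t0 : 0 < t by near: t; exact: nbhs_right_gt.
  have t1 : t < 1 by near: t; exact: nbhs_right_lt.
  apply: (@eq_mapnorm _ _ (fun X =>
      ((t^-1)%:C)%C *: (T t X - X - (t%:C)%C *: Lgen e H X))).
    move=> X; rewrite scalerBr scalerA -rmorphM /= mulVf ?gt_eqF//.
    by rewrite scale1r.
  apply: (@mapnorm_trans _ _ _ (rnorm ((t^-1)%:C)%C * (t * (t * M)))); last first.
    exact/mapnormZ/T_diff.
  rewrite rnorm_real gtr0_norm ?invr_gt0// mulKf ?gt_eqF//.
  have : t * (M + 1) <= eps.
    rewrite -ler_pdivlMr//; near: t; apply: nbhs_right_le; exact: divr_gt0.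
  by move: t0; nra.
Unshelve. all: by end_near. Qed.

End Generator.

(** * Invariant commutative algebras *)

Section CommutativeInvariant.
Context (R : realType) (G : hilbertType R).
Implicit Types (A B X Y H : bop G) (e f x : G) (C D : set (bop G)).

Lemma bracket_exp H Y n : GRing.comm (op_bracket H Y) Y ->
  op_bracket H (Y ^+ n.+1) = (Y ^+ n * op_bracket H Y) *+ n.+1.
Proof.
rewrite /op_bracket; set A := H * Y - Y * H => AY.
elim: n => [|n IH]; first by rewrite expr1 expr0 mul1r.
have -> : H * Y ^+ n.+2 - Y ^+ n.+2 * H =
    (H * Y ^+ n.+1 - Y ^+ n.+1 * H) * Y + Y ^+ n.+1 * A.
  rewrite [Y ^+ n.+2]exprSr /A; move: (Y ^+ n.+1) => Z.
  by rewrite mulrDl mulrDr bopNAl bopNAr !mulrA addrA subrK.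
rewrite IH [RHS]mulrSr; congr (_ + _).
by rewrite mulrnAl -mulrA AY mulrA -exprSr.
Qed.

(** The operator 1 + ihX stretches every vector, but only to second order in h. *)
Lemma rnorm_1iX X (h : R) x : selfadjoint X ->
  rnorm ((1 + ('i%C * h%:C%C) *: X) x) ^+ 2 = rnorm x ^+ 2 + h ^+ 2 * rnorm (X x) ^+ 2.
Proof.
move=> Xsa; apply: complexI; rewrite -ip_rnorm rmorphD /= -ip_rnorm rmorphM /= -ip_rnorm.
rewrite !(bopE, ipE) !rmorphM /= conj_i conj_RC -[ip x (X x)]Xsa.
set i := 'i%C; have i2 : i * i = -1 by exact: mul_ii.
have -> : ip x x + - i * h%:C%C * ip (X x) x +
   (i * h%:C%C * ip (X x) x + i * h%:C%C * (- i * h%:C%C * ip (X x) (X x))) =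
   ip x x - (i * i) * (h%:C%C * h%:C%C) * ip (X x) (X x) by ring.
by rewrite i2; ring.
Qed.

(** The Kleinecke-Shirokov theorem for a selfadjoint X.  Put Y = 1 + iX/m.  The
    bracket of H with Y^(m^2) is m^2 Y^(m^2 - 1) i[H,X]/m, and Y stretches
    vectors, so this bracket is at least m |[H,X] x| at x.  But Y^(m^2) is bounded
    uniformly in m, by [rnorm_1iX], and so is the bracket.  The limit is taken along
    m = 2^n. *)
Lemma bracket_comm_eq0 H X : selfadjoint X ->
  GRing.comm (op_bracket H X) X -> op_bracket H X = 0.
Proof.
move=> Xsa AX; set A := op_bracket H X in AX *.
have [k k0 /opnormP Xk] := opnorm_ex X; have [c c0 /opnormP Hc] := opnorm_ex H.
pose q := expR (k ^+ 2).
have q0 : 0 <= q by exact: expR_ge0.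
have q1 : 1 <= q by rewrite -[X in X <= _]expR0 ler_expR sqr_ge0.
apply/bopP => x; apply: (@small_eq0 _ _ _ (2 * (c * (q * rnorm x)))) => n.
pose h : R := (2 ^+ n)^-1; pose Y : bop G := 1 + ('i%C * h%:C%C) *: X.
have p0 : 0 < (2 : R) ^+ n by rewrite exprn_gt0.
have h0 : 0 < h by rewrite invr_gt0.
have BY : op_bracket H Y = ('i%C * h%:C%C) *: A.
  rewrite /Y /A /op_bracket mulrDl mulrDr mulr1 mul1r bopZAl bopZAr opprD addrACA.
  by rewrite subrr add0r scalerBr.
have YA : GRing.comm (op_bracket H Y) Y.
  rewrite BY /GRing.comm /Y [LHS]mulrDr [RHS]mulrDl mulr1 mul1r.
  by rewrite !bopZAl !bopZAr AX.
have Yge v m : rnorm v <= rnorm ((Y ^+ m) v).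
  elim: m => [|m IH]; first by rewrite expr0.
  rewrite exprS bopE (le_trans IH)//.
  rewrite -(@ler_pXn2r _ 2) ?nnegrE ?rnorm_ge0// rnorm_1iX// lerDl.
  by rewrite mulr_ge0 ?sqr_ge0.
have Yle v m : rnorm ((Y ^+ m) v) ^+ 2 <= (1 + h ^+ 2 * k ^+ 2) ^+ m * rnorm v ^+ 2.
  elim: m => [|m IH]; first by rewrite !expr0 mul1r.
  rewrite [Y ^+ _]exprS bopE rnorm_1iX// [(1 + _) ^+ m.+1]exprS -mulrA.
  apply: (@le_trans _ _ ((1 + h ^+ 2 * k ^+ 2) * rnorm ((Y ^+ m) v) ^+ 2)).
    rewrite mulrDl mul1r lerD2l -mulrA -[k ^+ 2 * _]exprMn ler_wpM2l ?sqr_ge0//.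
    by rewrite ler_pXn2r ?nnegrE ?mulr_ge0 ?rnorm_ge0.
  by rewrite ler_wpM2l// addr_ge0// mulr_ge0 ?sqr_ge0.
pose N := (2 ^ n * 2 ^ n)%N.
have N0 : (0 < N)%N by rewrite muln_gt0 !expn_gt0.
have YN v : rnorm ((Y ^+ N) v) <= q * rnorm v.
  rewrite -(@ler_pXn2r _ 2) ?nnegrE ?mulr_ge0 ?rnorm_ge0//.
  apply: le_trans (Yle _ _) _; rewrite exprMn ler_wpM2r ?sqr_ge0//.
  apply: (@le_trans _ _ q); last by rewrite expr2 ler_peMl.
  have -> : q = expR (h ^+ 2 * k ^+ 2) ^+ N.
    rewrite -expRM_natl /q /N natrM !natrX /h; congr expR; field.
    by rewrite gt_eqF.
  by rewrite lerXn2r ?nnegrE ?expR_ge0 ?expR_ge1Dx// addr_ge0// mulr_ge0 ?sqr_ge0.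
have key : N%:R * (h * rnorm (A x)) <= c * (q * rnorm x) + q * (c * rnorm x).
  have -> : N%:R * (h * rnorm (A x)) = N%:R * rnorm (op_bracket H Y x).
    by rewrite BY bopE rnormZ rnormM rnorm_i rnorm_real gtr0_norm// mul1r.
  apply: (@le_trans _ _ (rnorm (op_bracket H (Y ^+ N) x))).
    rewrite -(prednK N0) bracket_exp// prednK//.
    rewrite -[(_ * op_bracket H Y) *+ _]scaler_nat bopZ rnormZ.
    have -> : rnorm (N%:R : R[i]) = N%:R.
      by rewrite -(rmorph_nat (@real_complex R)) rnorm_real ger0_norm.
    by rewrite ler_wpM2l// bopE.
  rewrite /op_bracket !bopE; apply: le_trans (rnormB _ _) _; apply: lerD.
    by apply: le_trans (Hc _) _; rewrite ler_wpM2l.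
  by apply: le_trans (YN _) _; rewrite ler_wpM2l.
rewrite ler_pdivlMr//.
have : N%:R * h = 2 ^+ n by rewrite /N natrM natrX /h mulfK// gt_eqF.
move: key; rewrite mulrA => + NE; rewrite NE.
lra.
Qed.


(** For a unit vector e this is -[P,X]^2. *)
Definition dissipation e X : bop G := let P := rank1 e in
  P * X * X * P - P * X * P * X - X * P * X * P + X * P * X.

(** The Hamiltonian part is a derivation and drops out; what remains of K is
    K + K* = -P. *)
Lemma dissipationE e H X :
  Lgen e H (X * X) - Lgen e H X * X - X * Lgen e H X = dissipation e X.
Proof.
rewrite /dissipation !LgenE /=.
have KK : Kgen e H + Kgen' e H = - rank1 e.
  rewrite /Kgen /Kgen' addrACA subrr add0r -opprD -scalerDl.
  have -> : 2^-1 + 2^-1 = 1 :> R[i] by field.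
  by rewrite scale1r.
have E : X * rank1 e * X = - (X * Kgen e H * X + X * Kgen' e H * X).
  by rewrite -mulrDl -mulrDr KK bopNAr bopNAl opprK.
rewrite [X in _ = _ + X]E; move: (Kgen e H) (Kgen' e H) (rank1 e) {KK E} => K K' P.
rewrite !mulrDl !mulrDr !mulrA.
by rewrite !opprD !addrA [LHS](ACl ((((((((1*4)*7)*8)*6)*2)*5)*3)*9))%AC /= !addrK.
Qed.

Lemma dissipation_rank2 e X x : selfadjoint X -> `|e| = 1 ->
  let f := X e - ip (X e) e *: e in
  dissipation e X x = (ip f f * ip x e) *: e + ip x f *: f.
Proof.
move=> Xsa e1 f; pose a := ip (X e) e.
have ee : ip e e = 1 by rewrite ip_norm e1 expr1n.
have aR : a^* = a by rewrite /a -ipC Xsa.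
have Xe : X e = a *: e + f by rewrite addrC subrK.
have fe : ip f e = 0 by rewrite /f !ipE ee mulr1 subrr.
have ef : ip e f = 0 by rewrite ipC fe rmorph0.
clearbody f.
have Xxe y : ip (X y) e = a * ip y e + ip y f by rewrite Xsa Xe !ipE aR.
rewrite /dissipation !(bopD, bopN, bopME) !rank1E !bopZr !ipZl !Xxe -/a.
rewrite Xe !ipE ee ef mulr1 mulr0 add0r addr0.
have comb (b1 b2 b3 b4 : R[i]) : b1 *: e - b2 *: e - b3 *: (a *: e + f) +
    b4 *: (a *: e + f) = (b1 - b2 - b3 * a + b4 * a) *: e + (b4 - b3) *: f.
  rewrite -addrA [- _ + _]addrC -scalerBl -scalerBl scalerDr scalerA addrA -scalerDl.
  by congr (_ *: _ + _); ring.
rewrite comb.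
congr (_ *: _ + _ *: _); ring.
Qed.

(** Either every selfadjoint X in C has e as an eigenvector, and C is scalar; or
    some X does not, and then the projection onto the span of e and X e is in C
    and equals 1. *)
Lemma invariant_dichotomy e H C : `|e| = 1 -> selfadjoint H ->
  commutant [set H] `&` commutant [set rank1 e] = scalar_ops G ->
  von_neumann_algebra C -> commutative_set C ->
  generator_invariant (Lgen e H) C ->
  C `<=` scalar_ops G \/
  exists X f, [/\ C X, `|f| = 1, ip f e = 0,
    (forall x, x = ip x e *: e + ip x f *: f) &
    exists a b, b != 0 /\ X e = a *: e + b *: f].
Proof.
move=> e1 Hsa HP [[C0 Clin CM] C1 Cadj _] Ccomm CL.
have CZ a X : C X -> C (a *: X) by move=> CX; rewrite -[_ *: _]addr0; exact: Clin.
have CD X Y : C X -> C Y -> C (X + Y).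
  by move=> CX CY; rewrite -[X]scale1r; exact: Clin.
have CN X : C X -> C (- X) by move=> CX; rewrite -scaleN1r; exact: CZ.
have ee : ip e e = 1 by rewrite ip_norm e1 expr1n.
have PP := rank1_idem e1.
(* The last hypothesis cancels the dissipative part of L(X), so L(X) = i[H,X]. *)
have CHX X : selfadjoint X -> C X -> X * rank1 e = rank1 e * X ->
    rank1 e * X * rank1 e = 2^-1 *: (rank1 e * X + X * rank1 e) ->
    scalar_ops G X.
  move=> Xsa CX XP PXP; rewrite -HP; split=> A /= ->; last by rewrite /GRing.comm XP.
  have := CL _ CX; rewrite /Lgen PXP subrr add0r => /(CZ 'i%C^-1).
  rewrite scalerA mulVf ?i_neq0// scale1r => CHX.
  apply/subr0_eq; apply: (bracket_comm_eq0 Xsa); exact: Ccomm.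
have half_double (A : bop G) : 2^-1 *: (A + A) = A.
  rewrite scalerDr -scalerDl; have -> : 2^-1 + 2^-1 = 1 :> R[i] by field.
  by rewrite scale1r.
have [Ce|] := pselect (forall X, C X -> selfadjoint X -> X e = ip (X e) e *: e).
  left.
  have Csa X : C X -> selfadjoint X -> scalar_ops G X.
    move=> CX Xsa; have Xe := Ce _ CX Xsa.
    have aR : (ip (X e) e)^* = ip (X e) e by rewrite -ipC Xsa.
    have XP : X * rank1 e = rank1 e * X.
      apply/bopP => x; rewrite !bopME !rank1E bopZr [ip (X x) e]Xsa.
      by rewrite Xe ipZr aR scalerA mulrC.
    by apply: CHX => //; rewrite XP half_double -mulrA XP mulrA PP.
  move=> Y CY; have [Y' CY' YY'] := Cadj _ CY.
  have [a _ aE] : scalar_ops G (Y + Y').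
    apply: Csa; first exact: CD.
    rewrite /selfadjoint [X in is_adjoint _ X]addrC.
    by apply: is_adjointD => //; exact: is_adjoint_sym.
  have [b _ bE] : scalar_ops G ('i%C *: (Y - Y')).
    apply: Csa; first by apply: CZ; apply: CD => //; exact: CN.
    rewrite /selfadjoint [X in is_adjoint _ X](_ : _ = 'i%C^* *: (Y' + (-1)^* *: Y)).
      apply: is_adjointZ; rewrite -scaleN1r; apply: is_adjointD => //.
      by apply: is_adjointZ; exact: is_adjoint_sym.
    by rewrite conj_i rmorphN rmorph1 scaleN1r scaleNr -scalerN opprB.
  exists (2^-1 * (a - 'i%C * b)) => //.
  rewrite -scalerA scalerBl -scalerA aE bE scalerA.
  by rewrite mul_ii scaleN1r opprK addrACA subrr addr0 half_double.
move=> /existsNP[X /not_implyP[CX /not_implyP[Xsa /eqP Xe]]]; right.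
(* f is the normalized component of X e orthogonal to e. *)
pose f0 := X e - ip (X e) e *: e; pose r := rnorm f0.
have r0 : 0 < r by rewrite rnorm_gt0 subr_eq0.
pose f := (r^-1)%:C%C *: f0.
have f0E : f0 = r%:C%C *: f.
  by rewrite /f scalerA -rmorphM /= mulfV ?gt_eqF// scale1r.
have f1 : rnorm f = 1 by rewrite /f rnormZ rnorm_real gtr0_norm ?invr_gt0// mulVf// gt_eqF.
have ff : ip f f = 1 by rewrite ip_rnorm f1 expr1n.
have f0e : ip f0 e = 0 by rewrite /f0 !ipE ee mulr1 subrr.
have fe : ip f e = 0 by rewrite /f ipZl f0e mulr0.
have ef : ip e f = 0 by rewrite ipC fe rmorph0.
clearbody f; pose Q := rank1 e + rank1 f.
have QE x : Q x = ip x e *: e + ip x f *: f by [].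
have CQ : C Q.
  have -> : Q = (r^-1 ^+ 2)%:C%C *: dissipation e X.
    apply/bopP => x; rewrite bopZ dissipation_rank2// -/f0 QE f0E !ipE conj_RC ff mulr1.
    have rr : (r^-1 ^+ 2)%:C%C * (r%:C%C * r%:C%C) = 1 :> R[i].
      by rewrite -!rmorphM -[1]/((1 : R)%:C)%C; congr (_%:C)%C; field; rewrite gt_eqF.
    by rewrite scalerDr !scalerA; congr (_ *: _ + _ *: _); rewrite -[LHS]mul1r -rr; ring.
  rewrite -(dissipationE e H X); apply: CZ; do 2?apply: (CD _ _).
  - by apply/CL/CM.
  - by apply/CN/CM => //; exact: CL.
  - by apply/CN/CM => //; exact: CL.
have Qsa : selfadjoint Q by apply: is_adjointD; exact: rank1_selfadjoint.
have QP : Q * rank1 e = rank1 e.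
  by apply/bopP => x; rewrite bopME QE rank1E !ipZl ee ef mulr1 mulr0 scale0r addr0.
have PQ : rank1 e * Q = rank1 e.
  by apply/bopP => x; rewrite bopME !rank1E QE !ipE ee fe mulr1 mulr0 addr0.
have [q _ qE] : scalar_ops G Q.
  by apply: CHX; rewrite ?QP ?PQ ?PP ?half_double.
have Qe : Q e = e by rewrite QE ee ef scale1r scale0r addr0.
have q1 : q = 1.
  by rewrite -[LHS]mulr1 -ee -ipZl; have -> : q *: e = e by rewrite -[RHS]Qe -qE.
exists X, f; split => //.
- by rewrite -rnormE f1.
- by move=> x; rewrite -QE -qE q1 scale1r.
- exists (ip (X e) e), r%:C%C; split; last by rewrite -f0E addrC subrK.
  by rewrite eq_complex /= gt_eqF.
Qed.

End CommutativeInvariant.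

(** * Maximal abelian subalgebras *)

Section Masa.
Context (R : realType) (G : hilbertType R).
Implicit Types (A B X Y H : bop G) (e f x : G) (C D : set (bop G)).

(** In the two-dimensional case 1 and X span C: subtract from Y the combination
    that agrees with it at e.  The difference W kills e and commutes with X, so it
    kills X e, hence everything. *)
Lemma invariant_dim_le2 e H C : `|e| = 1 -> selfadjoint H ->
  commutant [set H] `&` commutant [set rank1 e] = scalar_ops G ->
  von_neumann_algebra C -> commutative_set C ->
  generator_invariant (Lgen e H) C -> dim_le 2 C.
Proof.
move=> e1 Hsa HP vC Ccomm CL; have [_ C1 _ _] := vC.
have [Cs|[X [f [CX _ _ xE [a [b [b0 Xe]]]]]]] :=
  invariant_dichotomy e1 Hsa HP vC Ccomm CL.
  exists (fun=> 1); split=> // Y /Cs[a _ <-].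
  exists (fun i => if i == 0 then a else 0).
  by rewrite !big_ord_recl big_ord0 /= scale0r !addr0.
exists (fun i => if i == 0 then 1 else X); split=> [i|Y CY]; first by case: ifP.
pose c := ip (Y e) f / b; pose d := ip (Y e) e - c * a.
have YX : Y * X = X * Y by exact: Ccomm.
pose W : bop G := Y - (d *: (1 : bop G) + c *: X : bop G).
have We : W e = 0.
  rewrite /W !bopE Xe {1}(xE (Y e)) scalerDr !scalerA addrA -scalerDl /d subrK.
  by rewrite /c divfK// subrr.
have WX : W * X = X * W.
  by rewrite /W mulrDl mulrDr bopNAl bopNAr mulrDl mulrDr !bopZAl !bopZAr mul1r mulr1 YX.
have Wf : W f = 0.
  have fE : f = b^-1 *: (X e - a *: e).
    by rewrite Xe addrC addKr scalerA mulVf// scale1r.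
  rewrite fE bopZr bopDr bopNr bopZr We scaler0 oppr0 addr0.
  by rewrite -[W (X e)]/((W * X) e) WX bopME We bop0r scaler0.
exists (fun i => if i == 0 then d else c).
rewrite !big_ord_recl big_ord0 addr0 /=.
apply/subr0_eq/bopP => x; rewrite -[Y - _]/W (xE x) bopDr !bopZr We Wf.
by rewrite !scaler0 addr0.
Qed.

(** The matrices of the two systems in each other satisfy A B = 1, with A of
    size m by n. *)
Lemma hilbert_dim_ge_le m n (v : 'I_n -> G) :
  (forall x, x = \sum_i ip x (v i) *: v i) -> hilbert_dim_ge G m -> (m <= n)%N.
Proof.
move=> vE [u uo].
apply: (@mulmx1_min _ _ _ (\matrix_(i < m, j < n) ip (u i) (v j))
  (\matrix_(j < n, i < m) ip (v j) (u i))).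
apply/matrixP => i k; rewrite !mxE -uo [in RHS](vE (u i)).
by rewrite ip_suml; apply: eq_bigr => j _; rewrite !mxE ipZl.
Qed.

(** The dichotomy leaves C scalar, since the other case is two-dimensional.  By
    maximality C then contains the algebra spanned by 1 and P, so P = 1. *)
Lemma masa_not_invariant e H C : `|e| = 1 -> selfadjoint H ->
  commutant [set H] `&` commutant [set rank1 e] = scalar_ops G ->
  hilbert_dim_ge G 3 -> masa C -> ~ generator_invariant (Lgen e H) C.
Proof.
move=> e1 Hsa HP dim3 [vC Ccomm Cmax] CL.
have ee : ip e e = 1 by rewrite ip_norm e1 expr1n.
have [Cs|[_ [f [_ _ _ xE _]]]] := invariant_dichotomy e1 Hsa HP vC Ccomm CL; last first.
  suff : (3 <= 2)%N by [].
  apply: (@hilbert_dim_ge_le _ _ (fun i => if i == 0 then e else f)) dim3 => x.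
  by rewrite !big_ord_recl big_ord0 addr0 /=; exact: xE.
pose D : set (bop G) := [set A | exists a b, A = a *: (1 : bop G) + b *: rank1 e].
have PP := rank1_idem e1.
have Dmul (a b a' b' : R[i]) :
    (a *: (1 : bop G) + b *: rank1 e : bop G) * (a' *: (1 : bop G) + b' *: rank1 e : bop G) =
    (a * a') *: (1 : bop G) + (a * b' + b * a' + b * b') *: rank1 e.
  rewrite mulrDl !mulrDr !bopZAl !bopZAr !mul1r mulr1 PP !scalerA.
  by rewrite -addrA -!scalerDl addrA.
have D1 : subalgebra D.
  split.
  - by exists 0, 0; rewrite !scale0r addr0.
  - move=> c _ _ [a [b ->]] [a' [b' ->]]; exists (c * a + a'), (c * b + b').
    by rewrite scalerDr !scalerA addrACA -!scalerDl.
  - move=> _ _ [a [b ->]] [a' [b' ->]]; rewrite Dmul.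
    by exists (a * a'), (a * b' + b * a' + b * b').
have D2 : commutative_set D.
  move=> _ _ [a [b ->]] [a' [b' ->]]; rewrite /GRing.comm !Dmul.
  by congr (_ *: _ + _ *: _); ring.
have CD : C `<=` D by move=> X /Cs[a _ <-]; exists a, 0; rewrite scale0r addr0.
have [q _ qE] : scalar_ops G (rank1 e).
  by apply/Cs/(Cmax _ D1 D2 CD); exists 0, 1; rewrite scale0r add0r scale1r.
have Pe : rank1 e e = e by rewrite rank1E ee scale1r.
have q1 : q = 1.
  by rewrite -[LHS]mulr1 -ee -ipZl; have -> : q *: e = e by rewrite -[RHS]Pe -qE.
suff : (3 <= 1)%N by [].
apply: (@hilbert_dim_ge_le _ _ (fun=> e)) dim3 => x.
by rewrite big_ord_recl big_ord0 addr0 -rank1E -qE q1 scale1r.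
Qed.

(** The difference quotients of the semigroup lie in C and converge to L(X) in
    norm, hence weakly. *)
Lemma semigroup_generator_invariant T (L : bop G -> bop G) C :
  generator_of T L -> von_neumann_algebra C ->
  semigroup_invariant T C -> generator_invariant L C.
Proof.
move=> TL [[_ Clin _] _ _ Cwot] CT X CX; apply: Cwot => s eps eps0.
have [k k0 Xk] := opnorm_ex X.
pose S := \sum_(p <- s) rnorm p.1 * rnorm p.2.
have S0 : 0 <= S by apply: sumr_ge0 => p _; rewrite mulr_ge0 ?rnorm_ge0.
have kS : 0 < k * S + 1 by rewrite ltr_wpDl// mulr_ge0.
have eta0 : 0 < eps / (k * S + 1) by rewrite divr_gt0.
have [t [t0 tT]] : exists t, 0 < t /\
    mapnorm_le (fun X => (t^-1)%:C%C *: (T t X - X) - L X) (eps / (k * S + 1)).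
  apply: (@filter_ex _ (0 : R)^'+); apply: filterI; last exact: TL.
  exact: nbhs_right_gt.
exists ((t^-1)%:C%C *: (T t X - X)).
  rewrite -[_ *: _]addr0; apply: (Clin _ _ _).
    rewrite addrC -scaleN1r; apply: (Clin _ _ _) => //; exact/CT/CX/ltW.
  by rewrite -(subrr X) addrC -scaleN1r; exact: Clin.
move=> p ps; rewrite -rnormE ltcR.
apply: le_lt_trans (rnorm_ip _ _) _.
have /opnormP/(_ p.1) := tT _ _ Xk.
have pS : rnorm p.1 * rnorm p.2 <= S.
  by rewrite /S (big_rem p ps) /= lerDl sumr_ge0// => q _; rewrite mulr_ge0 ?rnorm_ge0.
move=> /(ler_wpM2r (rnorm_ge0 p.2)) /le_lt_trans; apply.
rewrite -[X in X < _]mulrA.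
apply: (@le_lt_trans _ _ (eps / (k * S + 1) * k * S)).
  by rewrite ler_wpM2l// mulr_ge0// ltW.
by rewrite -mulrA mulrAC ltr_pdivrMr// ltr_pM2l// ltrDl.
Qed.

Lemma semigroup_no_masa e H : `|e| = 1 -> selfadjoint H ->
  commutant [set H] `&` commutant [set rank1 e] = scalar_ops G ->
  hilbert_dim_ge G 3 ->
  exists T : R -> bop G -> bop G,
    [/\ markov_semigroup T, uniformly_continuous T
      & forall C : set (bop G), masa C -> ~ semigroup_invariant T C].
Proof.
move=> e1 Hsa HP dim3; have [T [Tm Tc TL]] := Lgen_semigroup e1 Hsa.
exists T; split=> // C Cm CT; apply: (masa_not_invariant e1 Hsa HP dim3 Cm).
by apply: semigroup_generator_invariant TL _ CT; case: Cm.
Qed.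

End Masa.

(** * Selfadjoint operators and vectors with trivial commutant *)

Section Existence.
Context (R : realType) (G : hilbertType R).
Implicit Types (A B X Y H : bop G) (e f x y : G).

(** Both a dense sequence and a padded finite basis have this property, and it
    gives totality without the projection theorem ([separating_ortho]). *)
Definition separating (s : nat -> G) := forall A, (forall n, A (s n) = 0) -> A = 0.

(** The rank-one operator of x vanishes on the sequence. *)
Lemma separating_ortho s x : separating s -> (forall n, ip x (s n) = 0) -> x = 0.
Proof.
move=> sep xs; have : rank1 x = 0.
  by apply: sep => n; rewrite rank1E ipC xs rmorph0 scale0r.
move=> /(congr1 (fun A : bop G => A x)) /eqP; rewrite rank1E ip_rnorm.
rewrite bop0E scaler_eq0 => /orP[|/eqP//].
by rewrite RC_eq0 sqrf_eq0 => /eqP/rnorm0_eq0.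
Qed.

(** Vectors depending on their predecessors become 0, the inverse of a zero norm
    being 0; so the sequence is infinite in finite dimension too. *)
Fixpoint gram_schmidt_seq (s : nat -> G) n : seq G :=
  if n is m.+1 then
    let w := s m - \sum_(v <- gram_schmidt_seq s m) ip (s m) v *: v in
    rcons (gram_schmidt_seq s m) ((rnorm w)^-1%:C%C *: w)
  else [::].

Definition gram_schmidt s n : G := nth 0 (gram_schmidt_seq s n.+1) n.

Definition gram_schmidt_residue s n : G :=
  s n - \sum_(i < n) ip (s n) (gram_schmidt s i) *: gram_schmidt s i.

Lemma gram_schmidt_seqE s n : gram_schmidt_seq s n = mkseq (gram_schmidt s) n.
Proof.
have size_gs m : size (gram_schmidt_seq s m) = m by elim: m => //= m IH; rewrite size_rcons IH.
apply: (@eq_from_nth _ 0); rewrite ?size_gs ?size_mkseq// => i.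
elim: n => // n IH; rewrite ltnS leq_eqVlt => /orP[/eqP ->|lin].
  by rewrite nth_mkseq.
by rewrite [LHS]/= nth_rcons size_gs lin IH// !nth_mkseq// ltnW.
Qed.

Lemma gram_schmidtE s n :
  gram_schmidt s n =
    (rnorm (gram_schmidt_residue s n))^-1%:C%C *: gram_schmidt_residue s n.
Proof.
rewrite {1}/gram_schmidt /= nth_rcons gram_schmidt_seqE size_mkseq ltnn eqxx.
rewrite big_map /gram_schmidt_residue.
rewrite -(big_mkord xpredT (fun i => ip (s n) (gram_schmidt s i) *: gram_schmidt s i)).
by rewrite /index_iota subn0.
Qed.

Lemma gram_schmidt_residueE s n :
  gram_schmidt_residue s n = (rnorm (gram_schmidt_residue s n))%:C%C *: gram_schmidt s n.
Proof.
have [r0|r0] := eqVneq (gram_schmidt_residue s n) 0; first by rewrite r0 rnorm0 scale0r.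
rewrite gram_schmidtE scalerA -rmorphM mulfV ?scale1r//.
by rewrite gt_eqF// rnorm_gt0.
Qed.

Lemma gram_schmidt_norm s n : gram_schmidt s n = 0 \/ rnorm (gram_schmidt s n) = 1.
Proof.
rewrite gram_schmidtE.
have [->|r0] := eqVneq (gram_schmidt_residue s n) 0; first by left; rewrite scaler0.
have {}r0 : 0 < rnorm (gram_schmidt_residue s n) by rewrite rnorm_gt0.
by right; rewrite rnormZ rnorm_real gtr0_norm ?invr_gt0// mulVf// gt_eqF.
Qed.

Lemma gram_schmidt_ortho s i j : i != j -> ip (gram_schmidt s i) (gram_schmidt s j) = 0.
Proof.
suff H n m : (m < n)%N -> ip (gram_schmidt s n) (gram_schmidt s m) = 0.
  rewrite neq_ltn => /orP[ij|]; last exact: H.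
  by rewrite ipC H// rmorph0.
elim/ltn_ind: n m => n IH m mn; rewrite gram_schmidtE ipZl ipDl ipNl.
rewrite ip_suml (bigD1 (Ordinal mn))//= big1 ?addr0 => [|k km]; last first.
  have {}km : k != m :> nat by [].
  rewrite ipZl; move: km; rewrite neq_ltn => /orP[km|mi].
    by rewrite [ip (gram_schmidt s k) _]ipC (IH _ mn _ km) conjC0 mulr0.
  by rewrite (IH _ (ltn_ord k) _ mi) mulr0.
rewrite ipZl ip_rnorm; have [->|->] := gram_schmidt_norm s m.
  by rewrite ip0r mul0r subrr mulr0.
by rewrite expr1n mulr1 subrr mulr0.
Qed.

Lemma gram_schmidt_separating s : separating s -> separating (gram_schmidt s).
Proof.
move=> sep A Au; apply: sep => n.
have -> : s n = gram_schmidt_residue s n +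
    \sum_(i < n) ip (s n) (gram_schmidt s i) *: gram_schmidt s i.
  by rewrite subrK.
rewrite bopDr gram_schmidt_residueE bopZr Au scaler0 add0r.
by rewrite bop_sumr big1// => i _; rewrite bopZr Au scaler0.
Qed.

(** Distinct and summable: the eigenvalues of H, and the coordinates of e before
    normalization. *)
Definition eigval (n : nat) : R := (2 ^+ n)^-1.

Section OrthonormalSystem.
Variable u : nat -> G.
Hypothesis (u_norm : forall n, u n = 0 \/ rnorm (u n) = 1).
Hypothesis (u_ortho : forall i j, i != j -> ip (u i) (u j) = 0).
Hypothesis (u_sep : separating u).

Let eigval_gt0 n : 0 < eigval n. Proof. by rewrite invr_gt0 exprn_gt0. Qed.

Let u_le1 n : rnorm (u n) <= 1.
Proof. by have [->|->] := u_norm n; rewrite ?rnorm0. Qed.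

Let u_idem n (a : R[i]) : a * ip (u n) (u n) *: u n = a *: u n.
Proof.
have [->|un] := u_norm n; first by rewrite !scaler0.
by rewrite ip_rnorm un expr1n mulr1.
Qed.

Let sum_ortho (a : nat -> R[i]) n m : (m < n)%N ->
  ip (\sum_(i < n) a i *: u i) (u m) = a m * ip (u m) (u m).
Proof.
move=> mn; rewrite ip_suml (bigD1 (Ordinal mn))//= big1 ?addr0 => [|i im].
  by rewrite ipZl.
by rewrite ipZl u_ortho ?mulr0.
Qed.

(** The limit of the sums of (1/2^i) u_i u_i*. *)
Lemma diagonal_operator : exists2 H, selfadjoint H &
  forall n, H (u n) = (eigval n)%:C%C *: u n.
Proof.
pose Hn n : bop G := \sum_(i < n) (eigval i)%:C%C *: rank1 (u i).
have Hn_cauchy n : opnorm_le (Hn n.+1 - Hn n) (1 / 2 ^+ n).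
  rewrite /Hn big_ord_recr /= addrAC subrr add0r; apply/opnormP => x.
  rewrite bopZ rank1E !rnormZ rnorm_real gtr0_norm// mul1r ler_wpM2l ?(ltW (eigval_gt0 n))//.
  apply: le_trans (ler_pM _ _ (rnorm_ip _ _) (u_le1 n)) _; rewrite ?rnorm_ge0//.
  by rewrite mulr1 ler_piMr ?rnorm_ge0.
have [H HP] := geometric_bop Hn_cauchy.
have Hn_sa n : selfadjoint (Hn n).
  rewrite /Hn; elim: n => [|n IH]; first by move=> x y; rewrite !big_ord0 !bop0E ip0l ip0r.
  rewrite big_ord_recr /=; apply: is_adjointD => //.
  by rewrite -[X in is_adjoint _ (X *: _)]conj_RC; apply/is_adjointZ/rank1_selfadjoint.
exists H.
  move=> x y; apply/subr0_eq/rnorm0_eq0/(@real_small0 _ _ (4 * (rnorm x * rnorm y))) => n.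
  rewrite ger0_norm ?rnorm_ge0//.
  have -> : ip (H x) y - ip x (H y) = ip ((H - Hn n) x) y - ip x ((H - Hn n) y).
    by rewrite !bopD !bopN ipDl ipDr ipNl ipNr Hn_sa opprB addrA subrK.
  apply: le_trans (rnormB _ _) _.
  have -> : 4 * (rnorm x * rnorm y) / 2 ^+ n =
    2 * 1 / 2 ^+ n * rnorm x * rnorm y + rnorm x * (2 * 1 / 2 ^+ n * rnorm y) by ring.
  apply: lerD; apply: le_trans (rnorm_ip _ _) _.
    by rewrite ler_wpM2r ?rnorm_ge0//; have /opnormP := HP n; exact.
  by rewrite ler_wpM2l ?rnorm_ge0//; have /opnormP := HP n; exact.
move=> m; apply/subr0_eq/(@small_eq0 _ _ _ (2 * 1)) => n.
have Hm : Hn (m.+1 + n)%N (u m) = (eigval m)%:C%C *: u m.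
  rewrite /Hn; have mn : (m < m.+1 + n)%N by rewrite addSn ltnS leq_addr.
  rewrite bop_suml; under eq_bigr do rewrite bopZ rank1E.
  rewrite (bigD1 (Ordinal mn))//= big1 ?addr0 => [|i im].
    by rewrite scalerA u_idem.
  by rewrite u_ortho 1?eq_sym// scale0r scaler0.
have /opnormP/(_ (u m)) := HP (m.+1 + n)%N; rewrite bopD bopN Hm => /le_trans; apply.
apply: (@le_trans _ _ (2 * 1 / 2 ^+ (m.+1 + n))).
  by rewrite ler_piMr// divr_ge0 ?mulr_ge0 ?exprn_ge0.
rewrite ler_wpM2l ?mulr_ge0// lef_pV2 ?posrE ?exprn_gt0//.
by rewrite ler_weXn2l ?ler1n// leq_addl.
Qed.

(** The limit e of the sums of u_i / 2^i.  By continuity an operator that is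
    diagonal on the u_n acts on the coordinates of e entry by entry. *)
Lemma weighted_vector : exists2 e, forall n, ip e (u n) = (eigval n)%:C%C * ip (u n) (u n) &
  forall (A : bop G) (a : nat -> R[i]), (forall n, A (u n) = a n *: u n) ->
    forall n, ip (A e) (u n) = (eigval n)%:C%C * a n * ip (u n) (u n).
Proof.
pose En n : G := \sum_(i < n) (eigval i)%:C%C *: u i.
have En_cauchy n : rnorm (En n.+1 - En n) <= 1 / 2 ^+ n.
  rewrite /En big_ord_recr /= addrAC subrr add0r rnormZ rnorm_real gtr0_norm// mul1r.
  by rewrite ler_piMr// ltW.
have [e eP] := geometric_cauchy En_cauchy.
have main (A : bop G) (a : nat -> R[i]) : (forall n, A (u n) = a n *: u n) ->
    forall n, ip (A e) (u n) = (eigval n)%:C%C * a n * ip (u n) (u n).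
  move=> Au m; have [k k0 /opnormP Ak] := opnorm_ex A.
  apply/subr0_eq/rnorm0_eq0/(@real_small0 _ _ (2 * k)) => n.
  rewrite ger0_norm ?rnorm_ge0//.
  have mn : (m < m.+1 + n)%N by rewrite addSn ltnS leq_addr.
  have <- : ip (A (En (m.+1 + n)%N)) (u m) = (eigval m)%:C%C * a m * ip (u m) (u m).
    rewrite -(@sum_ortho (fun i => (eigval i)%:C%C * a i) _ _ mn) /En.
    by rewrite bop_sumr; congr (ip _ _); apply: eq_bigr => i _; rewrite bopZr Au scalerA.
  rewrite -ipNl -ipDl -bopNr -bopDr; apply: le_trans (rnorm_ip _ _) _.
  apply: (@le_trans _ _ (rnorm (A (e - En (m.+1 + n)%N)))).
    by rewrite ler_piMr// rnorm_ge0.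
  have -> : 2 * k / 2 ^+ n = k * (2 / 2 ^+ n) by ring.
  apply: le_trans (Ak _) _; rewrite ler_wpM2l//.
  apply: le_trans (eP _) _; rewrite mulr1 ler_wpM2l// lef_pV2 ?posrE ?exprn_gt0//.
  by rewrite ler_weXn2l ?ler1n// leq_addl.
exists e => // n; have := main 1 (fun=> 1) _ n.
by rewrite mulr1; apply => m; rewrite scale1r.
Qed.

(** If B commutes with H, then B u_n lies in the eigenspace of u_n, whose
    eigenvalue is simple, so B u_n = a_n u_n.  If B commutes with ee*, then
    B e = b e, and comparing coordinates gives a_n = b whenever u_n is nonzero. *)
Lemma trivial_commutant_pair x0 : x0 != 0 -> exists e H, [/\ `|e| = 1, selfadjoint H &
  commutant [set H] `&` commutant [set rank1 e] = scalar_ops G].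
Proof.
move=> x00; have [H Hsa Hu] := diagonal_operator.
have [e0 e0u e0A] := weighted_vector.
have e00 : e0 != 0.
  apply: contra_neq x00 => e00; apply: (separating_ortho u_sep) => n.
  have := e0u n; rewrite e00 ip0l => /esym/eqP.
  rewrite mulf_eq0 RC_eq0 gt_eqF//=.
  have [->|un] := u_norm n; first by rewrite !ip0r.
  by rewrite ip_rnorm un expr1n RC_eq0 oner_eq0.
pose e := (rnorm e0)^-1%:C%C *: e0.
have r0 : 0 < rnorm e0 by rewrite rnorm_gt0.
have e1 : `|e| = 1.
  by rewrite -rnormE rnormZ rnorm_real gtr0_norm ?invr_gt0// mulVf// gt_eqF.
exists e, H; split => //; apply/seteqP; split; last first.
  by move=> _ [a _ <-]; split=> A _; rewrite /GRing.comm bopZAl bopZAr mul1r mulr1.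
move=> B [/(_ H erefl) HB /(_ (rank1 e) erefl) PB].
have ee : ip e e = 1 by rewrite ip_norm e1 expr1n.
pose b := ip (B e) e.
have Be0 : B e0 = b *: e0.
  have -> : e0 = (rnorm e0)%:C%C *: e by rewrite scalerA -rmorphM mulfV ?gt_eqF// scale1r.
  rewrite bopZr; have -> : B e = b *: e.
    have : (B * rank1 e) e = (rank1 e * B) e by rewrite PB.
    by rewrite !bopME !rank1E ee scale1r.
  by rewrite !scalerA; congr (_ *: _); ring.
pose a n := ip (B (u n)) (u n).
have Bu n : B (u n) = a n *: u n.
  apply/subr0_eq/(separating_ortho u_sep) => m.
  rewrite ipDl ipNl ipZl.
  have [->|nm] := eqVneq n m.
    rewrite /a; have [->|um] := u_norm m; first by rewrite !ip0r mul0r subrr.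
    by rewrite [ip (u m) (u m)]ip_rnorm um expr1n mulr1 subrr.
  rewrite u_ortho// mulr0 subr0.
  have : ip (H (B (u n))) (u m) = ip (B (u n)) (H (u m)) by exact: Hsa.
  rewrite -[H (B (u n))]/((H * B) (u n)) HB bopME !Hu bopZr ipZl ipZr conj_RC.
  move=> /eqP; rewrite -subr_eq0 -mulrBl mulf_eq0 => /orP[|/eqP//].
  rewrite -rmorphB /= RC_eq0 subr_eq0 (inj_eq invr_inj) -!natrX eqr_nat.
  by rewrite eqn_exp2l// (negbTE nm).
exists b => //; apply/esym/subr0_eq/u_sep => n.
rewrite bopD bopN Bu bopZ bop1E -scalerBl.
have [->|un] := u_norm n; first by rewrite scaler0.
have := e0A _ _ Bu n; rewrite Be0 ipZl e0u ip_rnorm un expr1n mulr1.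
rewrite mulr1 mulrC => /mulfI -> ; first by rewrite subrr scale0r.
by rewrite RC_eq0 gt_eqF.
Qed.

End OrthonormalSystem.
End Existence.

(** * The two dimension hypotheses *)

Section Dimension.
Context (R : realType) (G : hilbertType R).

Lemma no_invariant_masa_ex (s : nat -> G) : separating s -> hilbert_dim_ge G 3 ->
  exists T : R -> bop G -> bop G,
    [/\ markov_semigroup T, uniformly_continuous T
      & forall C : set (bop G), masa C -> ~ semigroup_invariant T C].
Proof.
move=> sep dim3; have [v vo] := dim3.
have v0 : v ord0 != 0.
  apply: contra_eq_neq (vo ord0 ord0) => ->.
  by rewrite ip0l eqxx eq_sym oner_eq0.
have [e [H [e1 Hsa HP]]] := trivial_commutant_pair (gram_schmidt_norm s)
  (@gram_schmidt_ortho _ _ s) (gram_schmidt_separating sep) v0.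
exact: semigroup_no_masa e1 Hsa HP dim3.
Qed.

Lemma finite_separating d : hilbert_dim G d -> exists s : nat -> G, separating s.
Proof.
move=> [u [_ uE]]; exists (fun n => oapp u 0 (insub n)) => A As.
apply/bopP => x; rewrite (uE x) bop_sumr big1// => i _.
by have := As i; rewrite valK /= bopZr => ->; rewrite scaler0.
Qed.

Lemma separable_separating : hilbert_separable G -> exists s : nat -> G, separating s.
Proof.
move=> [S [/countable_injP[f finj] Sdense]].
exists (fun n => xget 0 [set y | S y /\ f y = n]) => A As.
have AS y : S y -> A y = 0.
  move=> Sy; rewrite -[RHS](As (f y)); congr (A _).
  case: xgetP => [z -> [Sz fz]|/(_ y)[]//].
  by apply: finj; rewrite ?inE.
have [k k0 /opnormP Ak] := opnorm_ex A.
apply/bopP => x; apply: (@small_eq0 _ _ _ k) => n.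
have e0 : 0 < ((2 ^+ n)^-1%:C%C : R[i]).
  by rewrite -[0]/((0 : R)%:C)%C ltcR invr_gt0 exprn_gt0.
have ball0 : ball x ((2 ^+ n)^-1%:C%C : R[i]) !=set0 by exists x; exact: ballxx.
have [y [xy Sy]] := Sdense _ ball0 (ball_open _ _).
have -> : A x = A (x - y) by rewrite bopDr bopNr (AS y Sy) subr0.
apply: le_trans (Ak _) _; rewrite ler_wpM2l// -lecR rnormE; apply: ltW.
by move: xy; rewrite -ball_normE.
Qed.

Lemma hilbert_dim_ge3 d : (3 <= d)%N -> hilbert_dim G d -> hilbert_dim_ge G 3.
Proof.
move=> d3 [u [uo _]]; exists (fun i => u (widen_ord d3 i)) => i j.
by rewrite uo -(inj_eq val_inj).
Qed.

End Dimension.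

Theorem mainTheorem3 (R : realType) :
  (forall (G : hilbertType R) (e : G) (H : bop G),
     `|e| = 1 ->
     selfadjoint H ->
     commutant [set H] `&` commutant [set rank1 e] = scalar_ops G ->
     [/\ exists T : R -> bop G -> bop G,
           [/\ markov_semigroup T, uniformly_continuous T
             & generator_of T (Lgen e H)],
         forall C : set (bop G),
           von_neumann_algebra C -> commutative_set C ->
           generator_invariant (Lgen e H) C -> dim_le 2 C
       & hilbert_dim_ge G 3 ->
         forall C : set (bop G),
           masa C -> ~ generator_invariant (Lgen e H) C])
  /\ (forall (d : nat) (G : hilbertType R),
        (3 <= d)%N -> hilbert_dim G d ->
        exists T : R -> bop G -> bop G,
          [/\ markov_semigroup T, uniformly_continuous T
            & forall C : set (bop G), masa C -> ~ semigroup_invariant T C])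
  /\ (forall G : hilbertType R,
        hilbert_separable G -> hilbert_infinite G ->
        exists T : R -> bop G -> bop G,
          [/\ markov_semigroup T, uniformly_continuous T
            & forall C : set (bop G), masa C -> ~ semigroup_invariant T C]).
Proof.
split; last split.
- move=> G e H e1 Hsa HP; split.
  + exact: Lgen_semigroup.
  + by move=> C; exact: (invariant_dim_le2 e1 Hsa HP).
  + by move=> dim3 C; exact: (masa_not_invariant e1 Hsa HP).
- move=> d G d3 dimG; have [s sep] := finite_separating dimG.
  by apply: (no_invariant_masa_ex sep); exact: hilbert_dim_ge3 dimG.
- move=> G sepG infG; have [s sep] := separable_separating sepG.
  exact: (no_invariant_masa_ex sep (infG 3%N)).
Qed.
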